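(* Let $p$ be a prime. (i) Let $D\in\mathrm{Div}(C_p)$ be a divisor with $\deg(D)\geq0$. Then the limit $$\mathrm{Dim}_{\mathbb{R}}(H^0(D)):=\lim_{n\to\infty}p^{-n}\dim_{\mathrm{top}}\big(H^0(D)^{p^n}\big)$$ converges, and one has $\mathrm{Dim}_{\mathbb{R}}(H^0(D))=\deg(D)$. (ii) The following Riemann-Roch formula holds: $$\mathrm{Dim}_{\mathbb{R}}(H^0(D))-\mathrm{Dim}_{\mathbb{R}}(H^0(-D))=\deg(D),\qquad\forall D\in\mathrm{Div}(C_p).$$
   Context: Let $p$ be a prime and $H_p=\mathbb{Z}[1/p]\subset\mathbb{Q}$ the group of fractions whose denominator is a power of $p$. $C_p$ is the set of subgroups $H\subset\mathbb{R}$ which are abstractly isomorphic to $H_p$; the map $\lambda\mapsto\lambda H_p$ identifies $\mathbb{R}_+^*/p^{\mathbb{Z}}$ with $C_p$. $\mathbb{R}_{\max}=\mathbb{R}\cup\{-\infty\}$ is the max-plus semifield. $\mathcal{K}_p$ is the sheaf on the circle $\mathbb{R}_+^*/p^{\mathbb{Z}}$ of continuous $\mathbb{R}_{\max}$-valued functions that are piecewise affine in the variable $\lambda\in\mathbb{R}_+^*$ with slopes in $H_p$ (or constantly $-\infty$), with operations max and $+$. Its set of global sections is denoted $\mathcal{K}(C_p)=\Gamma(C_p,\mathcal{K}_p)$: an element $f\ne-\infty$ is a continuous, piecewise affine function $f:\mathbb{R}_+^*\to\mathbb{R}$ with slopes in $H_p$ and $f(p\lambda)=f(\lambda)$ for all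 $\lambda$. For such $f$ and $H=\lambda H_p$, the order of $f$ at $H$ is $\mathrm{Order}(f)(H)=\lambda\big(f'^+(\lambda)-f'^-(\lambda)\big)\in H$, where $f'^{\pm}$ are the right and left derivatives (independent of the choice of $\lambda$ with $H=\lambda H_p$). A divisor $D$ on $C_p$ is a map assigning to each $H\in C_p$ an element $D(H)\in H\subset\mathbb{R}$, zero except for finitely many $H$; divisors form a group $\mathrm{Div}(C_p)$ under pointwise addition, $D\ge0$ means $D(H)\geq0$ for all $H$, and $\deg(D)=\sum_{H\in C_p}D(H)\in\mathbb{R}$. The divisor of $f\in\mathcal{K}(C_p)$, $f\neq-\infty$, is $(f)(H)=\mathrm{Order}(f)(H)$. For $D\in\mathrm{Div}(C_p)$ set $H^0(D)=\{f\in\mathcal{K}(C_p)\mid D+(f)\geq0\}$, an $\mathbb{R}_{\max}$-module (containing the zero element $f=-\infty$ by convention). For $f\in\Gamma(C_p,\mathcal{K}_p)$ set $\|f\|_p=\max\{|h(\lambda)|_p/\lambda\mid\lambda\in C_p\}$, where $h(\lambda)\in H_p$ is the slope of $f$ at $\lambda$, $|\cdot|_p$ is the $p$-adic absolute value with $|p|_p=1/p$, and at a point of discontinuity of the slopes one takes the maximum of the two values $|h_\pm(\lambda)|_p/\lambda$ given by the right and left slopes (the quantity $|h(\lambda)|_p/\lambda$ is invariant under $\lambda\mapsto p\lambda$); one sets $\|-\infty\|_p=0$. For $\rho>0$ put $H^0(D)^\rho=\{f\in H^0(D)\mid\|f\|_p\leq\rho\}$. $\dim_{\mathrm{top}}$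 denotes the topological (Lebesgue) covering dimension, where spaces of functions carry the topology of uniform convergence ($\mathbb{R}_{\max}$ being identified with $[0,\infty)$ by the exponential map). $\mathrm{Dim}_{\mathbb{R}}(H^0(D))$ denotes the limit displayed in the claim, for an arbitrary divisor $D$. *)

(* Defs.v *)
From HB Require Import structures.
From mathcomp Require Import all_boot all_order all_algebra.
From mathcomp Require Import all_classical all_reals all_analysis.

Set Implicit Arguments.
Unset Strict Implicit.
Unset Printing Implicit Defensive.

Import Order.TTheory GRing.Theory Num.Theory numFieldNormedType.Exports.

Local Open Scope classical_set_scope.
Local Open Scope ring_scope.

Definition open_cover (T : topologicalType) (C : set (set T)) : Prop :=
  (forall U, C U -> open U) /\ \bigcup_(U in C) U = [set: T].

Definition refines (T : Type) (V C : set (set T)) : Prop :=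
  forall A, V A -> exists2 U, C U & A `<=` U.

Definition cover_order_le (T : Type) (V : set (set T)) (n : nat) : Prop :=
  forall x : T, ([set A | V A /\ A x] #<= `I_n)%card.

(* n bounds the number of members through a point, so this says dim T <= n - 1. *)
Definition covering_bound (T : topologicalType) (n : nat) : Prop :=
  forall C : set (set T), finite_set C -> open_cover C ->
  exists V : set (set T),
    [/\ open_cover V, refines V C & cover_order_le V n].

(* The shift by 1 gives dim set0 = -1 and dim (point) = 0; the value is +oo if
   there is no bound. *)
Definition dim_top (R : realType) (T : topologicalType) : \bar R :=
  ereal_inf [set (n%:R - 1)%:E | n in [set n | covering_bound T n]].

Section ArithmeticCircle.
Variables (R : realType) (p : nat).

Definition Hp : set R :=
  [set x | exists (a : int) (n : nat), x = a%:~R / p%:R ^+ n].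

Definition subgroup (H : set R) : Prop :=
  H 0 /\ forall x y, H x -> H y -> H (x - y).

Definition Cp : set (set R) :=
  [set H | subgroup H /\ exists phi : R -> R,
     set_bij Hp H phi /\
     forall x y, Hp x -> Hp y -> phi (x + y) = phi x + phi y].

(* Cp is coerced to the subtype of its elements: the group operations on
   divisors are the pointwise ones of Cp -> R. *)
Definition Div : set (Cp -> R) :=
  [set D | (forall H : Cp, set_val H (D H)) /\
           finite_set [set H : Cp | D H != 0]].

Definition deg (D : Cp -> R) : R := \sum_(H \in [set: Cp]) D H.

Definition Rpos : set R := `]0, +oo[.

Definition affine_on (g : R -> R) (a b h : R) : Prop :=
  forall x, a <= x <= b -> g x = g a + h * (x - a).

(* Every [a, b] in the positive reals has a subdivision on each piece of which
   g is affine with slope in H_p. *)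
Definition piecewise_affine (g : R -> R) : Prop :=
  forall a b : R, 0 < a -> a < b -> exists2 s : seq R, itv_partition a b s &
    forall i, (i < size s)%N -> exists2 h : R, Hp h &
      affine_on g (nth a (a :: s) i) (nth a s i) h.

Definition Kzero : R -> \bar R := cst -oo%E.

(* R_max is the part of \bar R without +oo. A section is a function of
   lambda > 0; it is represented by a total function whose value for
   lambda <= 0 is fixed to -oo, so that the representation is unique. *)
Definition K : set (R -> \bar R) :=
  [set f | f = Kzero \/
    [/\ forall x : R, x <= 0 -> f x = -oo%E,
        forall x : R, 0 < x -> f x \is a fin_num,
        {in Rpos, continuous (fine \o f)},
        piecewise_affine (fine \o f) &
        forall x : R, 0 < x -> f (p%:R * x) = f x]].

Definition rderiv (g : R -> R) (x : R) : R :=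
  lim ((fun h => (g (x + h) - g x) / h) @ 0^'+).

Definition lderiv (g : R -> R) (x : R) : R :=
  lim ((fun h => (g (x + h) - g x) / h) @ 0^'-).

Definition order_at (g : R -> R) (l : R) : R := l * (rderiv g l - lderiv g l).

(* The divisor of f <> -oo; xget chooses a lambda > 0 with H = lambda H_p, and
   by f(p lambda) = f(lambda) the value does not depend on the choice. *)
Definition divisor_of (f : R -> \bar R) (H : Cp) : R :=
  order_at (fine \o f)
    (xget 1 [set l | 0 < l /\ set_val H = [set l * x | x in Hp]]).

Definition H0 (D : Cp -> R) : set (R -> \bar R) :=
  [set f | K f /\ (f = Kzero \/ forall H : Cp, 0 <= D H + divisor_of f H)].

Definition padic_abs_rat (q : rat) : R :=
  if q == 0 then 0
  else p%:R ^ ((logn p `|denq q|%N)%:Z - (logn p `|numq q|%N)%:Z).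

(* For real x in H_p, which lies in Q; junk if x is irrational. *)
Definition padic_abs (x : R) : R :=
  padic_abs_rat (xget 0 [set q : rat | ratr q = x]).

(* Where the slope is continuous, both one-sided derivatives equal it. The
   supremum is taken in \bar R to avoid a default value for unbounded sets. *)
Definition Knorm (f : R -> \bar R) : \bar R :=
  if `[< f = Kzero >] then 0%E else
  ereal_sup [set (Num.max (padic_abs (rderiv (fine \o f) l) / l)
                          (padic_abs (lderiv (fine \o f) l) / l))%:E
            | l in Rpos].

Definition H0le (D : Cp -> R) (rho : R) : set (R -> \bar R) :=
  [set f | H0 D f /\ (Knorm f <= rho%:E)%E].

(* R_max is identified with [0, +oo[ by the exponential, with exp (-oo) = 0. *)
Definition expK (f : R -> \bar R) : {uniform` Rpos -> R} :=
  fun x => fine (expeR (f x)).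

Definition H0le_space (D : Cp -> R) (rho : R) : topologicalType :=
  initial_topology (fun f : H0le D rho => expK (set_val f)).

Definition dim_seq (D : Cp -> R) (n : nat) : \bar R :=
  ((p%:R ^- n)%:E * dim_top R (H0le_space D (p%:R ^+ n)))%E.

Definition DimR (D : Cp -> R) : \bar R := limn (dim_seq D).

End ArithmeticCircle.

Arguments Hp : clear implicits.
Arguments Cp : clear implicits.

(* Main.v *)
Require Import Defs.
From mathcomp Require Import all_boot all_order all_algebra.
From mathcomp Require Import fingroup perm zify ring lra.
From mathcomp Require Import all_classical all_reals all_analysis.

(* A nonzero section f of K is determined on [1, p] by a constant and by its
   kinks: f has slope jump J at t exactly when its divisor is t * J there, the
   slopes have mean zero, and the initial slope is p times the final one. If
   D + (f) >= 0 and ||f|| <= p^n, then the jumps of f lie in p^-n Z and D + (f)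
   is an effective divisor of degree deg D.

   Upper bound. Every kink off the support of D carries degree at least p^-n,
   so f has at most p^n deg D + O(1) kinks. Between two rational points without
   a kink in between, f changes by a rational number. Fix cosets i pi + Q, i < N,
   and let G_i be the set of f avoiding the i-th coset at all rational points.
   An f outside every G_i has a kink between any two of N rational points, so
   the G_i cover as soon as N exceeds the number of kinks plus one; and the sets
   f(q) < c, f(q) > c with c in the i-th coset make G_i zero-dimensional.

   Lower bound. Take m kinks of size p^-n with m < p^n deg D as large as possible
   under the congruence modulo p - 1 which makes the slopes lie in p^-n Z. Moving
   them with a fixed sum gives an (m - 1)-cube on which m - 1 values of f are
   independent coordinates, and Lebesgue's covering theorem for this cube
   follows from Kuhn's cubical form of Sperner's lemma. *)

(** The fundamental domain [[1, p)] turns the norm into integrality in both directions: there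
    [|h|_p <= p^n lambda < p^(n+1)], and as p-adic absolute values are powers of p the slope h has
    denominator at most [p^n]; conversely such a slope satisfies [|h|_p <= p^n <= p^n lambda]. The
    congruence modulo p - 1 comes from the initial slope, which is [-p/(p-1)] times the sum of the
    jumps and must lie in [H_p]. The spaces are never parametrized as a whole: kinks may merge or
    meet the support of D, and -oo is a limit of translates of any section. Hence the upper bound
    counts zero-dimensional pieces, N of them giving dimension at most N - 1, and the lower bound
    maps in a single cube. The two bounds differ by a constant independent of n (support of D,
    rounding, congruence, the additive constant of f, which is frozen in the cube), and the factor
    [p^-n] removes it. In negative degree only -oo is left, so the limit is [max(0, deg D)] for
    every D, and Riemann-Roch becomes [max(0, d) - max(0, -d) = d]. *)

Set Implicit Arguments.
Unset Strict Implicit.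
Unset Printing Implicit Defensive.

(** * Kuhn's cubical Sperner lemma *)

Lemma even_card_involution (T : finType) (A : {set T}) (f : T -> T) :
  {in A, forall x, [/\ f x \in A, f (f x) = x & f x != x]} -> ~~ odd #|A|.
Proof.
have [n] := ubnP #|A|; elim: n A => // n IHn A leAn fA.
have [->|[x Ax]] := set_0Vmem A; first by rewrite cards0.
have [fxA ffx fxx] := fA x Ax.
have cA : #|A| = #|A :\ x :\ f x|.+2.
  by rewrite (cardsD1 x) Ax (cardsD1 (f x) (A :\ x)) !inE fxx fxA.
rewrite cA /= negbK; apply: IHn; first by rewrite cA ltnS in leAn; apply: leq_trans leAn.
move=> y; rewrite !inE => /and3P[yfx yx Ay]; have [fyA ffy fyy] := fA y Ay.
split=> //; rewrite fyA andbT; apply/andP; split.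
  by apply: contra_neq yx => e; rewrite -ffy e ffx.
by apply: contra_neq yfx => e; rewrite -ffy e.
Qed.

Lemma odd_sum (I : finType) (P : pred I) (F : I -> nat) :
  odd (\sum_(i | P i) F i) = \big[addb/false]_(i | P i) odd (F i).
Proof. exact: (big_morph odd oddD). Qed.

(** * Parity of the doors of one labelled simplex *)

Section Doors.
Variables (n : nat) (c : 'I_n.+1 -> 'I_n.+1).

Definition full_labels := [forall a, exists l, c l == a].
Definition door_labels (i : 'I_n.+1) :=
  [forall a : 'I_n, exists l, (l != i) && (c l == a :> nat)].

(** Counting: the n vertices other than [i0] already attain all n labels below n, so they attain
    each exactly once and nothing else. *)
Lemma door_inj i0 : door_labels i0 ->
  {in [set~ i0] &, injective c} /\ (forall l, l != i0 -> c l < n).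
Proof.
move=> /forallP di0.
pose S := [set a : 'I_n.+1 | a < n].
have cS : #|S| = n.
  have -> : S = [set~ ord_max].
    apply/setP=> a; rewrite !inE -val_eqE /= ltn_neqAle -ltnS ltn_ord andbT.
    by [].
  by rewrite cardsC1 card_ord.
have sub : S \subset c @: [set~ i0].
  apply/fintype.subsetP=> a; rewrite inE => an.
  have /existsP[l /andP[li /eqP e]] := di0 (Ordinal an).
  by apply/imsetP; exists l; [rewrite !inE | apply: val_inj].
have cC : #|[set~ i0]| = n by rewrite cardsC1 card_ord.
have eqS : S = c @: [set~ i0].
  by apply/eqP; rewrite eqEcard sub cS -[leqRHS]cC leq_imset_card.
split; first by apply/imset_injP; rewrite -eqS cS cC.
move=> l li; have : c l \in c @: [set~ i0] by apply: imset_f; rewrite !inE.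
by rewrite -eqS inE.
Qed.

(** A fully labelled simplex has one door, opposite its vertex of label n. A simplex that has a door
    but is not full repeats exactly one label, and its doors are opposite the two vertices that
    share it. *)
Lemma odd_doors : odd #|[set i | door_labels i]| = full_labels.
Proof.
case: (boolP full_labels) => [/forallP fc|nfull].
  have cinj : injective c.
    apply/injectiveP/dinjectiveP/imset_injP.
    have -> : c @: 'I_n.+1 = [set: 'I_n.+1].
      by apply/setP=> a; rewrite inE; have /existsP[l /eqP <-] := fc a; rewrite imset_f.
    by rewrite cardsT.
  have /existsP[i0 /eqP ci0] := fc ord_max.
  have -> : [set i | door_labels i] = [set i0]; last by rewrite cards1.
  apply/setP=> i; rewrite !inE; apply/idP/eqP => [di|->].
    apply: contraTeq di => ii0; apply/negP => /door_inj[_ /(_ i0)].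
    by rewrite eq_sym ii0 ci0 ltnn => /(_ isT).
  apply/forallP=> a; have /existsP[l /eqP cl] := fc (widen_ord (leqnSn n) a).
  apply/existsP; exists l; rewrite cl eqxx andbT.
  by apply: contraTneq (ltn_ord a) => e; rewrite -leqNgt -[a : nat]/(widen_ord (leqnSn n) a : nat) -cl e ci0.
have [->|[i0]] := set_0Vmem [set i | door_labels i]; first by rewrite cards0.
rewrite inE => di0; have [cinj clt] := door_inj di0.
have ci0 : c i0 < n.
  rewrite ltn_neqAle -ltnS ltn_ord andbT; apply: contra nfull => /eqP ci0.
  apply/forallP=> a; have [an|na] := ltnP a n.
    have /existsP[l /andP[_ /eqP e]] := forallP di0 (Ordinal an).
    by apply/existsP; exists l; apply/eqP/val_inj.
  apply/existsP; exists i0; apply/eqP/val_inj; rewrite /= ci0.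
  by apply/eqP; rewrite eqn_leq na -ltnS ltn_ord.
have /existsP[i1 /andP[i10 /eqP /= ci1]] := forallP di0 (Ordinal ci0).
have -> : [set i | door_labels i] = [set i0; i1]; last by rewrite cards2 eq_sym i10.
apply/setP=> i; rewrite !inE; apply/idP/orP => [di|[/eqP->|/eqP->]] //.
  case: (eqVneq i i0) => [|ii0]; first by left.
  case: (eqVneq i i1) => [|ii1]; first by right.
  have /existsP[l /andP[li /eqP /= cl]] := forallP di (Ordinal (clt _ ii0)).
  have [e|li0] := eqVneq l i0.
    by case/eqP: ii1; apply: cinj; rewrite ?inE //; apply: val_inj; rewrite /= ci1 -e cl.
  by case/eqP: li; apply: cinj; rewrite ?inE //; apply: val_inj.
apply/forallP=> a; have /existsP[l /andP[li0 /eqP cl]] := forallP di0 a.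
have [e|li1] := eqVneq l i1; apply/existsP.
  by exists i0; rewrite eq_sym i10 -ci1 -e cl /=.
by exists l; rewrite li1 cl /=.
Qed.

End Doors.

(** * Kuhn's triangulation of the grid cube *)

Section Kuhn.
Variable m : nat.

(* The simplex (x, s) of Kuhn's triangulation is the lattice path from x in which
   coordinate j is increased at step s j. *)
Definition vertex k (x : {ffun 'I_k -> 'I_m.+1}) (s : 'S_k) (i : nat) :
  {ffun 'I_k -> nat} := [ffun j => x j + (s j < i)].

(** The boundary condition is asymmetric on purpose: a top face misses one label and a bottom face
    allows only small labels, so that doors on the boundary occur only where the last coordinate is
    0. *)
Definition kuhn_labelling k (L : {ffun 'I_k -> nat} -> nat) :=
  forall v : {ffun 'I_k -> nat}, (forall j, v j <= m.+1) ->
  [/\ L v <= k, forall j, v j = 0 -> L v <= j & forall j, v j = m.+1 -> L v <> j].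

Lemma vertex_le k (x : {ffun 'I_k -> 'I_m.+1}) s i j : vertex x s i j <= m.+1.
Proof.
rewrite ffunE; apply: (@leq_trans (x j).+1); last exact: ltn_ord.
by case: (_ < i)%N; rewrite ?addn1 ?addn0.
Qed.

Definition vlab k L x s (i : 'I_k.+1) : 'I_k.+1 := inord (L (@vertex k x s i)).
Definition kfull k L (t : {ffun 'I_k -> 'I_m.+1} * 'S_k) :=
  full_labels (vlab L t.1 t.2).

Lemma vlabE k L x s (i : 'I_k.+1) : kuhn_labelling L ->
  vlab L x s i = L (vertex x s i) :> nat.
Proof.
by move=> HL; have [h _ _] := HL _ (vertex_le x s i); rewrite inordK.
Qed.

Section Step.
Variables (k : nat) (L : {ffun 'I_k.+1 -> nat} -> nat).
Hypothesis HL : kuhn_labelling L.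
Local Notation n := k.+1.
Local Notation triple := ({ffun 'I_n -> 'I_m.+1} * 'S_n * 'I_n.+1)%type.

(** Dropping the first vertex of a lattice path moves its first step to the end, and dropping the
    last vertex does the converse; the step numbers then shift cyclically. *)
Definition pred_perm : 'S_n := perm (can_inj (@ord_predK n)).
Definition succ_perm : 'S_n := perm (can_inj (@ordSK n)).

(* The other simplex sharing the facet opposite to vertex i, unless that facet
   lies on the boundary of the cube. *)
Definition pivot (t : triple) : triple :=
  let: (x, s, i) := t in
  if i == ord0 then
    ([ffun j => inord (x j + (s j == ord0))], (s * pred_perm)%g, ord_max)
  else if i == ord_max then
    ([ffun j => inord (x j - (s j == ord_max))], (s * succ_perm)%g, ord0)
  else (x, (s * tperm (inord i.-1) (inord i))%g, i).

Definition boundary (t : triple) :=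
  let: (x, s, i) := t in
  if i == ord0 then x ((s^-1)%g ord0) == ord_max
  else if i == ord_max then x ((s^-1)%g ord_max) == ord0
  else false.

Definition doors : {set triple} := [set t | door_labels (vlab L t.1.1 t.1.2) t.2].

Lemma mem_doorsP x s i : reflect
  (forall a, a < n -> exists l : 'I_n.+1, l != i /\ L (vertex x s l) = a)
  ((x, s, i) \in doors).
Proof.
rewrite inE; apply: (iffP forallP) => /= [h a an|h a].
  by have /existsP[l /andP[li /eqP]] := h (Ordinal an); rewrite vlabE //; exists l.
have [l [li e]] := h a (ltn_ord a).
by apply/existsP; exists l; rewrite li vlabE // e eqxx.
Qed.

Lemma ord_predE (j : 'I_n) : j != ord0 -> ord_pred j = j.-1 :> nat.
Proof.
case: j => [[|j] hj] // _ /=.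
by rewrite modnDr modn_small // ltnW.
Qed.

Lemma ordS_E (j : 'I_n) : j != ord_max -> ordS j = j.+1 :> nat.
Proof. by move=> jm; rewrite /= modn_small // ltn_neqAle ltn_ord andbT. Qed.

Lemma ord_pred0 : ord_pred (ord0 : 'I_n) = ord_max.
Proof. by apply: val_inj; rewrite /= modn_small. Qed.

Lemma ordSmax : ordS (ord_max : 'I_n) = ord0.
Proof. by apply: val_inj; rewrite /= modnn. Qed.

Lemma vertex_pivot0 x s l : ~~ boundary (x, s, ord0) -> l <= n.-1 ->
  let t := pivot (x, s, ord0) in vertex t.1.1 t.1.2 l = vertex x s l.+1.
Proof.
rewrite /boundary /pivot !eqxx => nb ln /=; apply/ffunP=> j; rewrite !ffunE permM permE.
have [sj|sj] := eqVneq (s j) ord0.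
  have xj : x j != ord_max by rewrite -[j](permK s) sj.
  have lx : (x j).+1 < m.+1 by rewrite ltnS ltn_neqAle xj -ltnS ltn_ord.
  by rewrite sj ord_pred0 ltnNge ln addn0 addn1 inordK.
rewrite addn0 inord_val ord_predE //; congr (_ + _).
by case: (s j) sj => [[|u] hu].
Qed.

Lemma vertex_pivotm x s l : ~~ boundary (x, s, ord_max) -> l <= n.-1 ->
  let t := pivot (x, s, ord_max) in vertex t.1.1 t.1.2 l.+1 = vertex x s l.
Proof.
rewrite /boundary /pivot !eqxx /= => nb ln; apply/ffunP=> j; rewrite !ffunE permM permE.
have [sj|sj] := eqVneq (s j) ord_max.
  have xj : x j != ord0 by rewrite -[j](permK s) sj.
  have x0 : 0 < x j by rewrite lt0n.
  rewrite sj ordSmax /= inordK ?subn1 ?(leq_trans _ (ltn_ord (x j))) //.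
    by rewrite ltnNge ln addn0 addn1 prednK.
  by rewrite ltnS leq_pred.
by rewrite subn0 inord_val ordS_E.
Qed.

Lemma vertex_pivoti x s (i l : 'I_n.+1) : i != ord0 -> i != ord_max -> l != i ->
  let t := pivot (x, s, i) in vertex t.1.1 t.1.2 l = vertex x s l.
Proof.
move=> i0 im li; rewrite /= (negPf i0) (negPf im) /=.
apply/ffunP=> j; rewrite !ffunE permM; congr (_ + _).
have ip : 0 < i by rewrite lt0n.
have iN : i < n by rewrite ltn_neqAle -ltnS ltn_ord andbT.
have ip' : i.-1 < n by apply: leq_ltn_trans iN; apply: leq_pred.
have lni : (l : nat) != i by [].
by case: tpermP => [->|->|_ _] //; rewrite !inordK //; congr nat_of_bool; apply/idP/idP; lia.
Qed.

Lemma pivot_doors t : t \in doors -> ~~ boundary t -> pivot t \in doors.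
Proof.
case: t => [[x s] i] /mem_doorsP d nb.
have [i0|i0] := eqVneq i ord0.
  move: d nb; rewrite {}i0 => d nb.
  have := @vertex_pivot0 x s _ nb; rewrite [pivot _]surjective_pairing.
  rewrite [(pivot _).1]surjective_pairing /= => E.
  apply/mem_doorsP=> a /d[l [l0 <-]].
  have ln : l.-1 < n.+1 by apply: leq_ltn_trans (ltn_ord l); apply: leq_pred.
  have l1 : l.-1 <= k by rewrite -ltnS prednK ?lt0n // -ltnS.
  exists (Ordinal ln); rewrite E //= prednK ?lt0n //; split=> //.
  by rewrite -val_eqE /= neq_ltn ltnS l1.
have [im|im] := eqVneq i ord_max.
  move: d nb; rewrite {}im => d nb.
  have := @vertex_pivotm x s _ nb; rewrite [pivot _]surjective_pairing.
  rewrite [(pivot _).1]surjective_pairing /= => E.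
  apply/mem_doorsP=> a /d[l [lm <-]].
  have ln : l < n by rewrite ltn_neqAle -ltnS ltn_ord andbT.
  have p2 : (pivot (x, s, ord_max)).2 = ord0 by rewrite /pivot eqxx.
  by exists (Ordinal (ln : l.+1 < n.+1)); rewrite p2 E.
have := @vertex_pivoti x s i _ i0 im; rewrite [pivot _]surjective_pairing.
rewrite [(pivot _).1]surjective_pairing /= => E.
have -> : (pivot (x, s, i)).2 = i by rewrite /= (negPf i0) (negPf im).
by apply/mem_doorsP=> a /d[l [li <-]]; exists l; rewrite E.
Qed.

(** The pivots at the first and at the last vertex are inverse to each other; a pivot at an inner
    vertex swaps the two steps around it and is its own inverse. *)
Lemma pivotK t : ~~ boundary t ->
  [/\ ~~ boundary (pivot t), pivot (pivot t) = t & pivot t != t].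
Proof.
have mn0 : (ord_max : 'I_n.+1) != ord0 by [].
case: t => [[x s] i]; rewrite /boundary /pivot.
have [i0|i0] := eqVneq i ord0.
  move=> nb; rewrite (negPf mn0) eqxx.
  have xj j : s j = ord0 -> (x j).+1 < m.+1.
    move=> sj; rewrite ltnS ltn_neqAle -ltnS ltn_ord andbT.
    by rewrite -[j](permK s) sj.
  have sE j : (s * pred_perm)%g j = ord_pred (s j) by rewrite permM permE.
  have smax j : (ord_pred (s j) == ord_max) = (s j == ord0).
    by rewrite -ord_pred0 (can_eq (@ord_predK n)).
  split; last by rewrite i0 xpair_eqE negb_and mn0 orbT.
    have sj : s (((s * pred_perm)^-1)%g ord_max) = ord0.
      by apply/eqP; rewrite -smax -sE permKV.
    by rewrite ffunE sj eqxx addn1 -val_eqE /= inordK ?xj.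
  rewrite i0; congr (_, _, _).
    apply/ffunP=> j; rewrite !ffunE sE smax.
    have [sj|_] := eqVneq (s j) ord0.
      by apply: val_inj; rewrite /= addn1 !inordK ?xj // subn1 //= ltnW // xj.
    by rewrite subn0 addn0 !inord_val.
  by apply/permP=> j; rewrite permM permE sE ord_predK.
have [im|im] := eqVneq i ord_max.
  move=> nb; rewrite eqxx.
  have xj j : s j = ord_max -> 0 < x j.
    by move=> sj; rewrite lt0n -[j](permK s) sj.
  have sE j : (s * succ_perm)%g j = ordS (s j) by rewrite permM permE.
  have smax j : (ordS (s j) == ord0) = (s j == ord_max).
    by rewrite -ordSmax (can_eq (@ordSK n)).
  have pm j : (x j).-1 < m.+1 by apply: leq_ltn_trans (ltn_ord (x j)); apply: leq_pred.
  split; last by rewrite im xpair_eqE negb_and eq_sym mn0 orbT.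
    have sj : s (((s * succ_perm)^-1)%g ord0) = ord_max.
      by apply/eqP; rewrite -smax -sE permKV.
    rewrite ffunE sj eqxx subn1 -val_eqE /= inordK //.
    by apply: contraTneq (ltn_ord (x (((s * succ_perm)^-1)%g ord0))) => e;
      rewrite -leqNgt -(prednK (xj _ sj)) e.
  rewrite im; congr (_, _, _).
    apply/ffunP=> j; rewrite !ffunE sE smax.
    have [sj|_] := eqVneq (s j) ord_max.
      by apply: val_inj; rewrite /= subn1 !inordK // addn1 prednK ?xj.
    by rewrite addn0 subn0 !inord_val.
  by apply/permP=> j; rewrite permM permE sE ordSK.
move=> _; rewrite (negPf i0) (negPf im); split=> //.
  by rewrite -mulgA tperm2 mulg1.
have ip : 0 < i by rewrite lt0n.
have iN : i < n by rewrite ltn_neqAle -ltnS ltn_ord andbT.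
have ip' : i.-1 < n by apply: leq_ltn_trans iN; apply: leq_pred.
rewrite xpair_eqE negb_and; apply/orP; left; rewrite xpair_eqE eqxx /=; apply/eqP => /(canRL (mulKg _)).
rewrite mulVg => /permP/(_ (inord i)); rewrite tpermR perm1 => /(congr1 val)/=.
by rewrite !inordK // => /eqP; rewrite -{2}(prednK ip) ltn_eqF.
Qed.

(** A facet on the top face of coordinate j lacks the label j, and one on the bottom face of j has
    labels at most j only. A door carries all labels up to k, which leaves the bottom face of the
    last coordinate. *)
Lemma boundary_doorsP x s i : (x, s, i) \in doors -> boundary (x, s, i) ->
  [/\ i = ord_max, x ord_max = ord0 & s ord_max = ord_max].
Proof.
move=> /mem_doorsP d; rewrite /boundary.
have [i0|i0] := eqVneq i ord0.
  move/eqP; set j := (s^-1)%g ord0 => xj.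
  have [l [li0 e]] := d j (ltn_ord j).
  have [_ _ /(_ j)] := HL (vertex_le x s l).
  have l0 : 0 < l by rewrite lt0n; move: li0; rewrite i0 -val_eqE.
  by rewrite ffunE xj permKV /= l0 addn1; case.
have [im|//] := eqVneq i ord_max.
move/eqP; set j := (s^-1)%g ord_max => xj.
have [l [li0 e]] := d k (ltnSn k).
have [_ /(_ j) h _] := HL (vertex_le x s l).
have jm : j = ord_max.
  apply: val_inj; apply/eqP; rewrite /= eqn_leq -ltnS ltn_ord -[X in X <= _]e h //.
  have lk : l <= k by move: li0 (ltn_ord l); rewrite im -val_eqE /=; lia.
  by rewrite ffunE xj permKV add0n /= ltnNge lk.
by split=> //; rewrite -jm // /j permKV.
Qed.

Definition low_label (v : {ffun 'I_k -> nat}) : nat :=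
  L [ffun j => if unlift ord_max j is Some j' then v j' else 0].

(** The bound on the labels drops by one because the last coordinate, of index k, is 0 on this
    face. *)
Lemma low_labelling : kuhn_labelling low_label.
Proof.
move=> v hv; pose w : {ffun 'I_n -> nat} :=
  [ffun j => if unlift ord_max j is Some j' then v j' else 0].
have hw j : w j <= m.+1 by rewrite ffunE; case: unlift.
have [_ h0 hM] := HL hw; split.
- by apply: (h0 ord_max); rewrite ffunE unlift_none.
- by move=> j vj; have := h0 (lift ord_max j); rewrite ffunE liftK lift_max; apply.
- by move=> j vj; have := hM (lift ord_max j); rewrite ffunE liftK lift_max; apply.
Qed.

(** A simplex of the bottom face becomes the facet opposite the last vertex of the simplex whose
    final step goes in the last coordinate. *)
Definition raise (t : {ffun 'I_k -> 'I_m.+1} * 'S_k) : triple :=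
  ([ffun j => if unlift ord_max j is Some j' then t.1 j' else ord0],
   lift_perm ord_max ord_max t.2, ord_max).

Lemma raise_inj : injective raise.
Proof.
move=> [x s] [y u] [/ffunP exy /permP esu]; congr (_, _).
  by apply/ffunP=> j; have := exy (lift ord_max j); rewrite !ffunE liftK.
apply/permP=> j; have := esu (lift ord_max j); rewrite !lift_perm_lift.
exact: lift_inj.
Qed.

Lemma vertex_raise x s (l : nat) : l <= k ->
  L (vertex (raise (x, s)).1.1 (raise (x, s)).1.2 l) = low_label (vertex x s l).
Proof.
move=> lk; congr L; apply/ffunP=> j; rewrite !ffunE.
case: unliftP => [j' ->|->] /=.
  by rewrite lift_perm_lift ffunE lift_max.
by rewrite lift_perm_id /= ltnNge lk.
Qed.

Lemma full_raise t : kfull low_label t = (raise t \in doors).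
Proof.
case: t => x s; rewrite [raise _]surjective_pairing.
rewrite [(raise _).1]surjective_pairing /=.
apply/forallP/mem_doorsP => [h a an|h a].
  have /existsP[l /eqP e] := h (Ordinal an).
  exists (widen_ord (leqnSn n) l).
  split; first by rewrite -val_eqE /= neq_ltn ltn_ord.
  rewrite (@vertex_raise x s l) -1?ltnS ?ltn_ord //.
  by rewrite -(vlabE _ _ _ low_labelling) e.
have [l [lm e]] := h a (ltn_ord a).
have lk : l < n by rewrite ltn_neqAle -ltnS ltn_ord andbT.
apply/existsP; exists (Ordinal lk); apply/eqP/val_inj.
by rewrite [LHS](vlabE _ _ _ low_labelling) /= -(@vertex_raise x s l).
Qed.

Lemma boundary_doors :
  [set t in doors | boundary t] = raise @: [set t | kfull low_label t].
Proof.
apply/setP=> t; rewrite inE; apply/andP/imsetP => [[]|[u]]; last first.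
  rewrite inE full_raise => du ->; split=> //; rewrite /boundary /raise eqxx.
  have -> : ((lift_perm ord_max ord_max u.2)^-1)%g ord_max = ord_max.
    by rewrite -[X in _ X = _](lift_perm_id ord_max ord_max u.2) permK.
  by rewrite /= ffunE unlift_none.
case: t => [[x s] i] dt /(boundary_doorsP dt)[im xm sm].
have sl j : exists j', s (lift ord_max j) == lift ord_max j'.
  case: (unliftP ord_max (s (lift ord_max j))) => [j' ->|e]; first by exists j'; rewrite eqxx.
  by have /eqP := etrans e (esym sm); rewrite (inj_eq perm_inj) eq_sym (negPf (neq_lift _ _)).
pose f j := xchoose (sl j).
have fE j : s (lift ord_max j) = lift ord_max (f j) by apply/eqP/(xchooseP (sl j)).
have finj : injective f.
  move=> a b e; have : s (lift ord_max a) = s (lift ord_max b) by rewrite !fE e.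
  by move/perm_inj/lift_inj.
have e : (x, s, i) = raise ([ffun j => x (lift ord_max j)], perm finj).
  rewrite im; congr (_, _, _).
    apply/ffunP=> j; rewrite ffunE; case: unliftP => [j' ->|->] //.
    by rewrite ffunE.
  apply/permP=> j; case: (unliftP ord_max j) => [j' ->|->].
    by rewrite lift_perm_lift permE fE.
  by rewrite lift_perm_id.
by exists ([ffun j => x (lift ord_max j)], perm finj); rewrite ?inE ?full_raise -?e.
Qed.

(** Doors are counted twice modulo 2. Simplex by simplex, they have the parity of the full
    simplices. Globally, [pivot] pairs the interior doors, and the boundary doors are the full
    simplices one dimension lower. *)
Lemma odd_full_step :
  odd #|[set t | kfull L t]| = odd #|[set t | kfull low_label t]|.
Proof.
have -> : odd #|[set t | kfull L t]| = odd #|doors|.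
  have -> : #|doors| = \sum_t #|[set i | door_labels (vlab L t.1 t.2) i]|.
    rewrite -sum1_card; under [RHS]eq_bigr do rewrite -sum1_card.
    rewrite pair_big_dep /=; apply: eq_bigl => -[t i]; by rewrite !inE.
  rewrite odd_sum -sum1_card big_mkcond odd_sum.
  by apply: eq_bigr => t _; rewrite odd_doors inE /kfull; case: full_labels.
rewrite -(card_imset _ raise_inj) -boundary_doors.
rewrite -(cardsID [set t | boundary t] doors) oddD.
have -> : doors :&: [set t | boundary t] = [set t in doors | boundary t].
  by apply/setP=> t; rewrite !inE.
suff /negPf -> : ~~ odd #|doors :\: [set t | boundary t]| by rewrite addbF.
apply: (even_card_involution (f := pivot)) => t.
rewrite inE => /andP[]; rewrite inE => nb dt; have [nb' ? ?] := pivotK nb.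
by split=> //; rewrite finset.in_setD pivot_doors // inE nb'.
Qed.

End Step.

Lemma odd_kfull k (L : {ffun 'I_k -> nat} -> nat) :
  kuhn_labelling L -> odd #|[set t | kfull L t]|.
Proof.
elim: k L => [|k IHk] L HL; last by rewrite odd_full_step // IHk //; apply: low_labelling.
have -> : [set t | kfull L t] = [set: {ffun 'I_0 -> 'I_m.+1} * 'S_0].
  apply/setP=> t; rewrite !inE; apply/forallP=> a; apply/existsP; exists ord0.
  by rewrite (ord1 a) (ord1 (vlab _ _ _ _)).
by rewrite cardsT card_prod card_ffun !card_ord expn0 card_Sn.
Qed.

Theorem kuhn k (L : {ffun 'I_k -> nat} -> nat) : kuhn_labelling L ->
  exists (x : {ffun 'I_k -> 'I_m.+1}) (s : 'S_k),
    forall a, a <= k -> exists2 i, i <= k & L (vertex x s i) = a.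
Proof.
move=> HL; have := odd_kfull HL.
have [->|[[x s]]] := set_0Vmem [set t | kfull L t]; first by rewrite cards0.
rewrite inE => /forallP h _; exists x, s => a ak.
have /existsP[i /eqP e] := h (Ordinal (ak : a < k.+1)).
by exists i; rewrite -1?ltnS ?ltn_ord // -(vlabE _ _ _ HL) e.
Qed.

End Kuhn.

Import Order.TTheory GRing.Theory Num.Theory numFieldNormedType.Exports.
Local Open Scope classical_set_scope.
Local Open Scope ring_scope.

(** * Covering dimension *)

Lemma finite_bigcap_open (T : topologicalType) (I : choiceType) (A : set I) (F : I -> set T) :
  finite_set A -> (forall i, A i -> open (F i)) -> open (\bigcap_(i in A) F i).
Proof.
move=> fA oF; rewrite -closedC setC_bigcap; apply: closed_bigcup => // i Ai.
by rewrite closedC; exact: oF.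
Qed.

Definition unit_cube (R : realType) k : set 'rV[R]_k :=
  [set u | forall i, 0 <= u ord0 i <= 1].

Lemma compact_unit_cube (R : realType) k : compact (@unit_cube R k).
Proof.
have -> : @unit_cube R k = [set u | forall i, `[0, 1]%classic (u ord0 i)].
  by apply/seteqP; split=> u hu i; have := hu i; rewrite /= in_itv.
by apply: (@rV_compact R k (fun=> `[0, 1]%classic)) => _; exact: segment_compact.
Qed.

(** Continuity along the cube only, with coordinatewise distance: [e] is a total function whose
    values outside the cube are arbitrary. *)
Definition cube_continuous (R : realType) k (T : topologicalType) (e : 'rV[R]_k -> T) :=
  forall u, unit_cube u -> forall U : set T, open U -> U (e u) ->
  exists2 d : R, 0 < d & forall u', unit_cube u' ->
    (forall i, `|u ord0 i - u' ord0 i| < d) -> U (e u').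

(** Compactness in its near-covering form: a radius [1 / (N + 1)] that works for all points near u,
    for each u, works uniformly for large N. *)
Lemma cube_lebesgue_number (R : realType) k (T : topologicalType)
    (e : 'rV[R]_k -> T) (V : set (set T)) : cube_continuous e -> open_cover V ->
  exists N : nat, forall u, unit_cube u -> exists A, V A /\
    forall u', unit_cube u' -> (forall i, `|u ord0 i - u' ord0 i| <= N.+1%:R^-1) -> A (e u').
Proof.
move=> ec [Vo Vc].
pose P (N : nat) (u : 'rV[R]_k) := exists A, V A /\
    forall u', unit_cube u' -> (forall i, `|u ord0 i - u' ord0 i| <= N.+1%:R^-1) -> A (e u').
have cP : \forall N \near \oo, @unit_cube R k `<=` P N.
  apply: (proj1 (compact_near_coveringP _) (@compact_unit_cube R k)) => u cu.
  have : [set: T] (e u) by [].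
  rewrite -Vc => -[A VA Au].
  have [d d0 hd] := ec u cu A (Vo A VA) Au.
  have d20 : 0 < d / 2 by rewrite divr_gt0.
  exists (ball u (d / 2), [set N | N.+1%:R^-1 < d / 2]).
    by split; [exact: nbhsx_ballx | exact: near_infty_natSinv_lt (PosNum d20)].
  move=> [u1 N] /= [bu1 hN]; exists A; split=> // u2 cu2 h.
  apply: hd => // i; have := bu1.2 ord0 i; rewrite /ball /= => b1.
  rewrite (splitr d); apply: le_lt_trans (ler_distD (u1 ord0 i) _ _) _.
  by apply: ltr_leD b1 (le_trans (h i) (ltW hN)).
have [N _ hN] := cP; exists N; exact: (hN N (leqnn N)).
Qed.

Definition leading_ones k (b : 'I_k -> bool) : nat :=
  find (fun i => ~~ b i) (enum 'I_k).

Lemma leading_ones_le k (b : 'I_k -> bool) : (leading_ones b <= k)%N.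
Proof. by rewrite -[leqRHS](size_enum_ord k) find_size. Qed.

Lemma leading_ones_zero k (b : 'I_k -> bool) j : ~~ b j -> (leading_ones b <= j)%N.
Proof.
move=> bj; rewrite leqNgt; apply/negP => /(before_find j).
by rewrite nth_ord_enum bj.
Qed.

Lemma leading_ones_neq k (b : 'I_k -> bool) j : b j -> leading_ones b <> j.
Proof.
move=> bj e; have := @nth_find _ j (fun i => ~~ b i) (enum 'I_k).
rewrite has_find -/(leading_ones b) e size_enum_ord ltn_ord nth_ord_enum bj.
by move=> /(_ isT).
Qed.

(* An open cover by 2^k sets, none of which meets two opposite faces: label a
   member of a refinement by the number of leading faces it avoids. *)
Lemma not_covering_bound_cube (R : realType) k (T : topologicalType)
    (e : 'rV[R]_k -> T) (g : 'I_k -> T -> R) (a b : 'I_k -> R) :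
  cube_continuous e -> (forall i, continuous (g i)) -> (forall i, a i < b i) ->
  (forall i u, unit_cube u -> u ord0 i = 0 -> g i (e u) <= a i) ->
  (forall i u, unit_cube u -> u ord0 i = 1 -> b i <= g i (e u)) ->
  ~ covering_bound T k.
Proof.
move=> ec gc ab ga gb cov.
pose U (be : {ffun 'I_k -> bool}) : set T :=
  \bigcap_(i in [set: 'I_k]) (if be i then g i @^-1` [set x | a i < x] else g i @^-1` [set x | x < b i]).
have Uo be : open (U be).
  apply: finite_bigcap_open; first exact: finite_finset.
  move=> i _; case: (be i); apply: open_comp => //.
have oU : open_cover (range U).
  split; first by move=> _ [be0 _ <-].
  apply/seteqP; split=> // y _.
  exists (U [ffun i => a i < g i y]); first by exists [ffun i => a i < g i y].
  move=> i _; rewrite ffunE; case: ifPn => //=; rewrite -leNgt => h.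
  by apply: le_lt_trans h (ab i).
have fU : finite_set (range U) by apply: finite_image; exact: finite_finset.
have [V [oV rV cV]] := cov _ fU oU.
have [N hN] := cube_lebesgue_number ec oV.
pose pt (v : {ffun 'I_k -> nat}) : 'rV[R]_k := \row_i ((v i)%:R / N.+1%:R).
have N0 : 0 < N.+1%:R :> R by [].
have cpt (v : {ffun 'I_k -> nat}) : (forall j, v j <= N.+1)%N -> unit_cube (pt v).
  by move=> hv i; rewrite mxE divr_ge0 //= ler_pdivrMr // mul1r ler_nat.
have /choice[A hA] : forall v : {ffun 'I_k -> nat}, exists B : set T,
    (forall j, v j <= N.+1)%N -> V B /\ forall u', unit_cube u' ->
      (forall i, `|pt v ord0 i - u' ord0 i| <= N.+1%:R^-1) -> B (e u').
  move=> v.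
  have [hv|hv] := pselect (forall j, v j <= N.+1)%N; last by exists setT.
  by have [A HA] := hN _ (cpt v hv); exists A.
have /choice[be hbe] : forall B : set T, exists be0 : {ffun 'I_k -> bool},
    V B -> B `<=` U be0.
  move=> B; have [VB|nVB] := pselect (V B); last by exists [ffun=> true].
  by have [_ [be _ <-] BU] := rV B VB; exists be.
pose L v := leading_ones (be (A v)).
have HL : @kuhn_labelling N k L.
  move=> v hv; have [VA AA] := hA v hv.
  have Uv : U (be (A v)) (e (pt v)).
    apply: (hbe _ VA); apply: AA; first exact: cpt.
    by move=> i; rewrite subrr normr0 invr_ge0 ltW.
  split; first exact: leading_ones_le.
    move=> j vj; apply: leading_ones_zero; apply/negP => bj.
    have := Uv j I; rewrite bj /= ltNge ga //; first exact: cpt.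
    by rewrite mxE vj mul0r.
  move=> j vj; apply: leading_ones_neq; apply/negPn/negP => /negPf bj.
  have := Uv j I; rewrite bj /= ltNge gb //; first exact: cpt.
  by rewrite mxE vj divff // lt0r_neq0.
have [x [s hx]] := kuhn HL.
have /choice[ix hix] : forall c, exists i,
    (c <= k)%N -> (i <= k)%N /\ L (vertex x s i) = c.
  move=> c; have [ck|kc] := leqP c k; last by exists 0%N.
  by have [i ik <-] := hx c ck; exists i.
(* The label depends only on the chosen member of [V], so k + 1 labels come from k + 1 distinct
   members. All contain the image of vertex 0, from which the other vertices differ by at most one
   grid step in each coordinate. *)
pose F c := A (vertex x s (ix c)).
have Finj : {in `I_k.+1 &, injective F}.
  move=> c d; rewrite !inE /= => hc hd E.
  have [_ ec'] := hix c hc; have [_ ed] := hix d hd.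
  by rewrite -ec' -ed /L; rewrite /F in E; rewrite E.
have FV : F @` `I_k.+1 `<=` [set B | V B /\ B (e (pt (vertex x s 0)))].
  move=> _ [c ck <-]; have [VA AA] := hA _ (vertex_le x s (ix c)).
  split=> //; apply: AA; first by apply: cpt; apply: vertex_le.
  move=> i; rewrite !mxE !ffunE ltn0 addn0 natrD mulrDl addrAC subrr add0r.
  by case: (_ < _)%N; rewrite ?mul1r ?mul0r ?normr0 ?ger0_norm // invr_ge0 ltW.
have := card_le_trans (subset_card_le FV) (cV _).
rewrite (card_le_eql (inj_card_eq Finj)) card_le_II ltnn.
by [].
Qed.

Lemma covering_boundW (T : topologicalType) m n : (m <= n)%N ->
  covering_bound T m -> covering_bound T n.
Proof.
move=> mn cm C fC oC; have [V [oV rV cV]] := cm C fC oC; exists V; split=> // x.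
by apply: card_le_trans (cV x) _; rewrite card_le_II.
Qed.

Lemma dim_top_ge (R : realType) (T : topologicalType) k :
  ~ covering_bound T k -> (k%:R%:E <= dim_top R T)%E.
Proof.
move=> nk; apply: le_ereal_inf_tmp => _ [n cn <-]; rewrite lee_fin lerBrDr.
rewrite natr1 ler_nat ltnNge; apply/negP => nk'.
by apply: nk; apply: covering_boundW cn.
Qed.

Lemma dim_top_le (R : realType) (T : topologicalType) n :
  covering_bound T n -> (dim_top R T <= (n%:R - 1)%:E)%E.
Proof. by move=> cn; apply: ereal_inf_lbound; exists n. Qed.

(* G i behaves like a zero-dimensional set: its points have arbitrarily small
   neighbourhoods B i k whose boundary misses G i. Removing the closures of the
   previous neighbourhoods yields, for each i, a disjoint family covering G i. *)
Lemma covering_bound_zero_dim (T : topologicalType) N (G : nat -> set T)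
    (B Bc : nat -> nat -> set T) :
  (forall x, exists2 i, (i < N)%N & G i x) ->
  (forall i k, (i < N)%N -> open (B i k)) ->
  (forall i k, (i < N)%N -> closed (Bc i k)) ->
  (forall i k, B i k `<=` Bc i k) ->
  (forall i k, Bc i k `&` G i `<=` B i k) ->
  (forall i x U, (i < N)%N -> G i x -> open U -> U x ->
     exists k, B i k x /\ B i k `<=` U) ->
  covering_bound T N.
Proof.
move=> GT Bo Bcc BBc BcG Bbase C fC [Co Cc].
pose good i k := exists2 U, C U & B i k `<=` U.
pose V i k := B i k `\` \bigcup_(j in [set j | (j < k)%N /\ good i j]) Bc i j.
pose W := [set A | exists i k, [/\ (i < N)%N, good i k & A = V i k]].
have fin i k : finite_set [set j | (j < k)%N /\ good i j].
  by apply: sub_finite_set (finite_II k) => j [].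
exists W; split.
- split.
    move=> _ [i [k [iN _ ->]]]; apply: openI; first exact: Bo.
    rewrite openC; apply: closed_bigcup => //.
    by move=> j _; apply: Bcc.
  apply/seteqP; split=> // x _; have [i iN Gx] := GT x.
  have : [set: T] x by []. rewrite -Cc => -[U CU Ux].
  have [k0 [Bk0 BU]] := Bbase i x U iN Gx (Co U CU) Ux.
  (* The least good index is taken: an earlier closure [Bc i j] containing x would, by [BcG], put x
     in [B i j], against minimality. *)
  have ex : exists k, `[< good i k /\ B i k x >].
    by exists k0; apply/asboolP; split=> //; exists U.
  case: (ex_minnP ex) => k /asboolP[gk Bk] kmin.
  exists (V i k); first by exists i, k.
  split=> // -[j [jk gj] Bcj].
  suff : (k <= j)%N by rewrite leqNgt jk.
  apply: kmin.
  by apply/asboolP; split=> //; apply: BcG.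
- move=> _ [i [k [iN [U CU BU] ->]]]; exists U => // y [By _]; exact: BU.
- move=> x.
  (* For fixed i the sets [V i k] with [good i k] are disjoint, a later one omitting the closure of
     an earlier one. So the members through x are among the N sets [h i]. *)
  have /choice[h hh] : forall i, exists A0, forall A, (i < N)%N ->
      (exists k, [/\ good i k, A = V i k & V i k x]) -> A0 = A.
    move=> i.
    have [[A [k [gk _ xk]]]|no] := pselect (exists A k, [/\ good i k, A = V i k & V i k x]); last first.
      by exists setT => A _ [k hk]; case: no; exists A, k.
    exists (V i k) => A' _ [k' [gk' -> xk']].
    have [kk'|kk'|->] // := ltngtP k k'.
      by case: xk' => _ []; exists k => //; apply: BBc; case: xk.
    by case: xk => _ []; exists k' => //; apply: BBc; case: xk'.
  apply: card_le_trans (card_image_le h `I_N).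
  apply: subset_card_le => A [[i [k [iN gk AE]]] Ax].
  by exists i => //; apply: hh => //; exists k; rewrite -AE.
Qed.

(** * The group Z[1/p] and the points of C_p *)

Section HpTheory.
Variables (R : realType) (p : nat).
Hypothesis hp : prime p.

Let p0 : 0 < p%:R :> R. Proof. by rewrite ltr0n prime_gt0. Qed.
Let pX0 n : 0 < p%:R ^+ n :> R. Proof. by rewrite exprn_gt0. Qed.
Let pX_neq0 n : p%:R ^+ n != 0 :> R. Proof. by rewrite gt_eqF. Qed.
Let p1 : 1 < p%:R :> R. Proof. by rewrite ltr1n prime_gt1. Qed.

Lemma Hp_denom (x : R) : Hp R p x <-> exists n (a : int), x * p%:R ^+ n = a%:~R.
Proof.
split=> [[a [n ->]]|[n [a e]]]; first by exists n, a; rewrite divfK.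
by exists a, n; rewrite -e mulfK.
Qed.

Lemma Hp_int (a : int) : Hp R p a%:~R.
Proof. by exists a, 0%N; rewrite expr0 divr1. Qed.

Lemma HpB x y : Hp R p x -> Hp R p y -> Hp R p (x - y).
Proof.
move=> /Hp_denom[n [a ea]] /Hp_denom[m [b eb]]; apply/Hp_denom.
exists (n + m)%N, (a * p%:Z ^+ m - b * p%:Z ^+ n).
rewrite rmorphB !rmorphM !rmorphXn /= -ea -eb exprD; ring.
Qed.

Lemma HpM x y : Hp R p x -> Hp R p y -> Hp R p (x * y).
Proof.
move=> /Hp_denom[n [a ea]] /Hp_denom[m [b eb]]; apply/Hp_denom.
by exists (n + m)%N, (a * b); rewrite rmorphM /= -ea -eb exprD mulrACA.
Qed.

Lemma HpN x : Hp R p x -> Hp R p (- x).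
Proof. by move=> hx; rewrite -[- x]add0r; apply: HpB hx; apply: (Hp_int 0). Qed.

Lemma HpD x y : Hp R p x -> Hp R p y -> Hp R p (x + y).
Proof. by move=> hx hy; rewrite -[y]opprK; apply: HpB => //; apply: HpN. Qed.

Lemma Hp_sum (I : Type) (s : seq I) (P : pred I) (F : I -> R) :
  (forall i, P i -> Hp R p (F i)) -> Hp R p (\sum_(i <- s | P i) F i).
Proof.
move=> hF; elim/big_ind: _ => //; first exact: (Hp_int 0).
by move=> x y; apply: HpD.
Qed.

Lemma Hp_nat n : Hp R p n%:R.
Proof. by have := Hp_int n; rewrite -pmulrn. Qed.

Lemma Hp_pinv n : Hp R p (p%:R ^- n).
Proof. by exists 1, n; rewrite mul1r. Qed.

Lemma Hp_rat x : Hp R p x -> exists q : rat, x = ratr q.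
Proof.
move=> [a [n ->]]; exists (a%:~R / p%:R ^+ n).
by rewrite fmorph_div rmorphXn /= ratr_int ratr_nat.
Qed.

Lemma padic_absE (q : rat) :
  padic_abs p (ratr q : R) = padic_abs_rat R p q.
Proof.
rewrite /padic_abs; case: xgetP => [q' -> e|/(_ q)]; last by case.
congr padic_abs_rat; exact: (fmorph_inj (@ratr R)).
Qed.

Lemma padic_abs_rat_neq0 (q : rat) : q != 0 -> padic_abs_rat R p q =
  p%:R ^+ logn p `|denq q|%N / p%:R ^+ logn p `|numq q|%N.
Proof.
by move=> q0; rewrite /padic_abs_rat (negPf q0) expfzDr ?gt_eqF // -exprz_inv -exprVn.
Qed.

Lemma padic_abs_le (x : R) m n (a : int) :
  x * p%:R ^+ m = a%:~R * p%:R ^+ n -> padic_abs p x <= p%:R ^+ m / p%:R ^+ n.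
Proof.
move=> e; have [q xq] : exists q : rat, x = ratr q.
  apply: Hp_rat; apply/Hp_denom; exists m, (a * p%:Z ^+ n).
  by rewrite e rmorphM rmorphXn.
rewrite xq padic_absE; have [->|q0] := eqVneq q 0.
  by rewrite /padic_abs_rat eqxx divr_ge0 // ltW.
rewrite padic_abs_rat_neq0 // ler_pdivrMr // mulrAC ler_pdivlMr // -!exprD.
rewrite ler_eXn2l //.
have eq : q * p%:R ^+ m = a%:~R * p%:R ^+ n.
  apply: (fmorph_inj (@ratr R)).
  by rewrite !rmorphM !rmorphXn /= -xq !ratr_nat ratr_int.
have ez : numq q * p%:Z ^+ m = a * p%:Z ^+ n * denq q.
  apply: (@intr_inj rat); rewrite !rmorphM !rmorphXn /=.
  by rewrite numqE mulrAC eq.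
have := congr1 (fun z => logn p `|z|%N) ez.
have numq0 : (0 < `|numq q|)%N by rewrite absz_gt0 numq_eq0.
have a0 : (0 < `|a|)%N.
  rewrite absz_gt0; apply: contra_eq_neq eq => ->.
  by rewrite mul0r mulf_neq0 // expf_neq0 // pnatr_eq0 -lt0n prime_gt0.
have den0 : (0 < `|denq q|)%N by rewrite absz_gt0 denq_neq0.
have pk0 k : (0 < p ^ k)%N by rewrite expn_gt0 prime_gt0.
rewrite !abszM !abszX /= !lognM ?muln_gt0 ?a0 ?pk0 //.
have lp : logn p p = 1%N by rewrite logn_prime // eqxx.
by rewrite !lognX lp; lia.
Qed.

(** The reduced denominator is some [p ^ j] with [j < n + 1]. The strict bound one power higher
    absorbs the factor lambda < p of the norm. *)
Lemma padic_abs_denom (x : R) n : Hp R p x -> padic_abs p x < p%:R ^+ n.+1 ->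
  exists a : int, x * p%:R ^+ n = a%:~R.
Proof.
move=> hx; have [q xq] := Hp_rat hx.
rewrite xq padic_absE; have [->|q0] := eqVneq q 0.
  by move=> _; exists 0; rewrite rmorph0 mul0r.
rewrite padic_abs_rat_neq0 //.
have [m [a e]] := proj1 (Hp_denom x) hx.
have eq : q * p%:R ^+ m = a%:~R.
  by apply: (fmorph_inj (@ratr R)); rewrite !rmorphM !rmorphXn /= -xq !ratr_nat ratr_int.
have d0 : (denq q)%:~R != 0 :> rat by rewrite intr_eq0 denq_neq0.
have ez : numq q * p%:Z ^+ m = a * denq q.
  apply: (@intr_inj rat); rewrite !rmorphM !rmorphXn /= -eq.
  by rewrite numqE mulrAC.
have dp : (`|denq q| %| p ^ m)%N.
  have := congr1 absz ez; rewrite !abszM abszX /= => ez'.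
  rewrite -(@Gauss_dvdr _ `|numq q|%N) ?ez' ?dvdn_mull //.
  by rewrite coprime_sym coprime_num_den.
have [j jm dj] := dvdn_pfactor _ _ hp dp.
rewrite dj pfactorK //.
have [j0|j0] := posnP j.
  move: dj; rewrite j0 expn0 => dj _; exists (numq q * p%:Z ^+ n).
  rewrite rmorphM rmorphXn /= -{1}(divq_num_den q).
  have -> : denq q = 1 by rewrite -[denq q]absz_denq dj.
  by rewrite divr1 ratr_int.
have pd : (p %| `|denq q|)%N by rewrite dj dvdn_exp.
have -> : logn p `|numq q|%N = 0%N.
  apply/eqP; rewrite -leqn0 leqNgt logn_gt0 mem_primes; apply/negP => /and3P[_ _ pn].
  have := coprime_num_den q; rewrite /coprime => /eqP g1.
  have : (p %| 1)%N by rewrite -g1 dvdn_gcd pn pd.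
  by rewrite dvdn1 => /eqP pe; move: hp; rewrite pe.
rewrite expr0 divr1 ltr_eXn2l // ltnS => jn; exists (numq q * p%:Z ^+ (n - j)).
rewrite rmorphM rmorphXn /= -{1}(divq_num_den q) fmorph_div /= !ratr_int.
have -> : (denq q)%:~R = p%:R ^+ j :> R.
  by rewrite -[denq q]absz_denq dj -pmulrn natrX.
by rewrite -{1}(subnK jn) exprD mulrA mulrAC divfK.
Qed.

(** Fundamental domain of the positive reals under scaling by powers of p. *)
Definition fdom (y : R) := 1 <= y < p%:R.

Lemma fdom_gt0 y : fdom y -> 0 < y.
Proof. by move=> /andP[y1 _]; apply: lt_le_trans y1. Qed.

Lemma fdom_uniq y z m n : fdom y -> fdom z -> y * p%:R ^+ m = z * p%:R ^+ n -> y = z.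
Proof.
wlog mn : y z m n / (m <= n)%N => [W fy fz e|].
  by have [?|/ltnW ?] := leqP m n; [exact: (W y z m n) | apply/esym; exact: (W z y n m)].
move=> /andP[y1 yp] /andP[z1 zp]; rewrite -(subnK mn) exprD mulrA => /(mulIf (pX_neq0 m)) e.
case: (n - m)%N e => [|k] e; first by rewrite e expr0 mulr1.
have : p%:R <= y.
  rewrite e exprS mulrCA; apply: ler_peMr; first exact: ltW.
  apply: (le_trans z1); apply: ler_peMr; first exact: le_trans z1.
  by rewrite exprn_ege1 // ltW.
by rewrite leNgt yp.
Qed.

Lemma fdom_exists (l : R) : 0 < l ->
  exists y k j, fdom y /\ l * p%:R ^+ j = y * p%:R ^+ k.
Proof.
move=> l0.
have bern n : n%:R <= p%:R ^+ n :> R by rewrite -natrX ler_nat ltnW // ltn_expl // prime_gt1.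
have [j jP] : exists j, 1 <= l * p%:R ^+ j.
  exists (Num.truncn l^-1).+1; rewrite mulrC -ler_pdivrMr // mul1r.
  apply: le_trans (bern _); apply/ltW; exact: truncnS_gt.
have [k kP] : exists k, l * p%:R ^+ j < p%:R ^+ k.+1.
  exists (Num.truncn (l * p%:R ^+ j)); apply: lt_le_trans (bern _); exact: truncnS_gt.
have ex : exists k, l * p%:R ^+ j < p%:R ^+ k.+1 by exists k.
case: (ex_minnP ex) => {kP}k kP kmin.
exists (l * p%:R ^+ j / p%:R ^+ k), k, j; split; last by rewrite divfK.
rewrite /fdom ler_pdivlMr // mul1r ltr_pdivrMr // -exprS kP andbT.
case: k kP kmin => [|k] _ kmin; first by rewrite expr0.
by rewrite leNgt; apply/negP => /kmin; rewrite ltnn.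
Qed.

Definition scaleHp (l : R) : set R := [set l * x | x in Hp R p].

(** The default at 0 makes [cls] below a total function, with no proof of [l != 0] to carry
    along. *)
Lemma Cp_scale (l : R) : Cp R p (scaleHp (if l == 0 then 1 else l)).
Proof.
set c := if _ then _ else _; have c0 : c != 0 by rewrite /c; case: (eqVneq l 0) => [_|]; rewrite ?oner_neq0.
split.
  split; first by exists 0; [exact: (Hp_int 0)|rewrite mulr0].
  by move=> _ _ [x hx <-] [y hy <-]; exists (x - y); [exact: HpB|rewrite mulrBr].
exists ( *%R c); split; last by move=> x y _ _; rewrite mulrDr.
split; first by move=> x hx; exists x.
  by move=> x y _ _ /(mulfI c0).
by [].
Qed.

Definition cls (l : R) : Cp R p := SigSub (mem_set (Cp_scale l)).

Lemma set_val_cls l : l != 0 -> set_val (cls l) = scaleHp l.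
Proof. by move=> l0; rewrite set_valE /= (negPf l0). Qed.

(** Up to powers of p, each of l and t is an integer multiple of the other. The two integers are
    positive with product [p ^ (m + n)], hence powers of p. *)
Lemma scaleHp_eq (l t : R) : 0 < l -> 0 < t -> scaleHp l = scaleHp t ->
  exists m n, l * p%:R ^+ m = t * p%:R ^+ n.
Proof.
move=> l0 t0 e.
have : scaleHp l l by exists 1; [exact: (Hp_int 1)|rewrite mulr1].
rewrite e => -[_ [a [m ->]] ea].
have : scaleHp t t by exists 1; [exact: (Hp_int 1)|rewrite mulr1].
rewrite -e => -[_ [b [n ->]] eb].
have tma : l * p%:R ^+ m = t * a%:~R by rewrite -ea -mulrA divfK.
have tnb : t * p%:R ^+ n = l * b%:~R by rewrite -eb -mulrA divfK.
have a0 : 0 < a.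
  by rewrite -(ltr0z R) -(pmulr_rgt0 _ t0) -tma mulr_gt0.
have b0 : 0 < b.
  by rewrite -(ltr0z R) -(pmulr_rgt0 _ l0) -tnb mulr_gt0.
have ab : (`|a| * `|b| = p ^ (m + n))%N.
  apply: (@mulrIn R 1); first exact: oner_neq0.
  rewrite natrM natrX !natr_absz !gtr0_norm //; apply: (mulfI (lt0r_neq0 t0)).
  by rewrite exprD !mulrA -tma mulrAC -tnb mulrAC.
have : (`|a| %| p ^ (m + n))%N by rewrite -ab dvdn_mulr.
move=> /(dvdn_pfactor _ _ hp)[i _ ai]; exists m, i.
by rewrite tma -natrX -ai natr_absz gtr0_norm.
Qed.

Lemma cls_inj t u : fdom t -> fdom u -> cls t = cls u -> t = u.
Proof.
move=> ft fu /(congr1 set_val); have t0 := fdom_gt0 ft; have u0 := fdom_gt0 fu.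
rewrite !set_val_cls ?gt_eqF // => /(scaleHp_eq t0 u0)[m [n]].
exact: fdom_uniq.
Qed.

(** An additive map on [H_p] with real values is multiplication by its value at 1. The sign of
    [phi 1] is absorbed by [H_p = - H_p], and a power of p brings its absolute value into the
    fundamental domain. *)
Lemma cls_surj (H : Cp R p) : exists2 t, fdom t & H = cls t.
Proof.
have [[H0 HB] [phi [[phiH phi_inj phi_surj] phiD]]] := set_valP H.
have phi0 : phi 0 = 0.
  have := phiD 0 0 (Hp_int 0) (Hp_int 0); rewrite addr0 => /eqP.
  by rewrite eq_sym addrC -subr_eq0 addrK => /eqP.
have phin x n : Hp R p x -> phi (x *+ n) = phi x *+ n.
  move=> hx; elim: n => [|n IHn]; first by rewrite !mulr0n.
  rewrite !mulrS phiD // ?IHn //; rewrite -mulr_natr; apply: HpM => //; exact: Hp_nat.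
have phiN x : Hp R p x -> phi (- x) = - phi x.
  by move=> hx; apply/eqP; rewrite -subr_eq0 opprK -phiD ?addNr ?phi0 //; exact: HpN.
have phiE x : Hp R p x -> phi x = phi 1 * x.
  move=> hx; have [a [n e]] := hx.
  have phia : phi a%:~R = phi 1 * a%:~R.
    have phk k : phi k%:R = phi 1 * k%:R by rewrite (phin 1 k (Hp_int 1)) mulr_natr.
    case: a {e} => k; first exact: phk.
    by rewrite NegzE mulrNz phiN -?pmulrn ?phk ?mulrN //; apply: Hp_nat.
  apply: (mulIf (pX_neq0 n)); rewrite -mulrA {2}e divfK // -phia.
  rewrite -natrX mulr_natr -phin // -mulr_natr natrX e divfK //.
have phi1 : phi 1 != 0.
  apply/eqP => e; have := phi_inj 1 0 (mem_set (Hp_int 1)) (mem_set (Hp_int 0)).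
  by rewrite e phi0 => /(_ erefl)/eqP; rewrite oner_eq0.
have HE : set_val H = scaleHp (phi 1).
  apply/seteqP; split=> [x /phi_surj[y hy <-]|_ [y hy <-]].
    by exists y => //; rewrite -phiE.
  by rewrite -phiE //; apply: phiH.
have l0 : 0 < `|phi 1| by rewrite normr_gt0.
have [y [k [j [fy e]]]] := fdom_exists l0.
exists y => //; apply: val_inj => /=.
have y0 := fdom_gt0 fy; rewrite gt_eqF //.
transitivity (set_val H) => //; rewrite HE.
have e1 : `|phi 1| = y * (p%:R ^+ k / p%:R ^+ j) by rewrite mulrA -e mulfK.
have e2 : y = `|phi 1| * (p%:R ^+ j / p%:R ^+ k) by rewrite mulrA e mulfK.
have hr i i' : Hp R p (p%:R ^+ i / p%:R ^+ i').
  by apply: HpM (Hp_pinv _); rewrite -natrX; apply: Hp_nat.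
have hs x : Hp R p x -> Hp R p (Num.sg (phi 1) * x).
  by move=> hx; case: sgrP => _; rewrite ?mul0r ?mul1r ?mulN1r //; [exact: (Hp_int 0)|exact: HpN].
apply/seteqP; split=> _ [x hx <-].
  exists (Num.sg (phi 1) * (p%:R ^+ k / p%:R ^+ j * x)).
    by apply: hs; apply: HpM.
  by rewrite mulrCA (mulrA y) -e1 mulrA -numEsg.
exists (Num.sg (phi 1) * (p%:R ^+ j / p%:R ^+ k * x)).
  by apply: hs; apply: HpM.
rewrite [in LHS]mulrA (mulrC (phi 1)) -normrEsg mulrA -e2 //.
Qed.

End HpTheory.

(** * One-sided slopes and kinks *)

Section Slopes.
Variable R : realType.
Implicit Types (g : R -> R) (x y h : R).

(** Exact affineness on a one-sided neighbourhood, stronger than a one-sided derivative: this is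
    what a subdivision into affine pieces can be rebuilt from. *)
Definition has_rslope g x h := exists2 d, 0 < d &
  forall y, x <= y <= x + d -> g y = g x + h * (y - x).
Definition has_lslope g x h := exists2 d, 0 < d &
  forall y, x - d <= y <= x -> g y = g x + h * (y - x).

Lemma rslopeE g x h : has_rslope g x h -> rderiv g x = h.
Proof.
move=> [d d0 hd]; apply: cvg_lim => //; apply: cvg_near_cst.
have : \forall e \near 0^'+, e <= d :> R by apply: nbhs_right_le.
apply: filterS2 (nbhs_right_gt 0) => e e0 ed.
rewrite hd ?lerDl ?lerD2l ?(ltW e0) // (addrAC (g x)) (addrAC x) !subrr !add0r.
by rewrite mulfK // gt_eqF.
Qed.

Lemma lslopeE g x h : has_lslope g x h -> lderiv g x = h.
Proof.
move=> [d d0 hd]; apply: cvg_lim => //; apply: cvg_near_cst.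
have : \forall e \near 0^'-, - d <= e :> R by apply: nbhs_left_ge; rewrite oppr_lt0.
apply: filterS2 (nbhs_left_lt 0) => e e0 ed.
rewrite hd ?gerDl ?lerD2l ?ed ?(ltW e0) //.
by rewrite (addrAC (g x)) (addrAC x) !subrr !add0r mulfK // lt_eqF.
Qed.

Lemma rslope_continuous g x h h' : has_rslope g x h -> has_lslope g x h' -> {for x, continuous g}.
Proof.
move=> [d d0 hd] [d' d'0 hd']; apply/cvgrPdist_le => e e0.
pose C := `|h| + `|h'| + 1; have C0 : 0 < C by rewrite ltr_wpDl // addr_ge0.
pose m := Num.min (Num.min d d') (e / C).
have m0 : 0 < m by rewrite !lt_min d0 d'0 divr_gt0.
near=> y; have : `|x - y| <= m by near: y; apply: cvgr_dist_le m0; exact: cvg_id.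
rewrite !le_min => /andP[/andP[yd yd'] ye].
have ye' : `|x - y| * C <= e by rewrite -ler_pdivlMr.
have key k : `|k| <= C -> g y = g x + k * (y - x) -> `|g x - g y| <= e.
  move=> kC ->; rewrite opprD addrA subrr add0r normrN normrM distrC.
  by rewrite mulrC (le_trans _ ye') // ler_wpM2l.
have h1 : `|h| <= C by rewrite /C -addrA lerDl addr_ge0.
have h2 : `|h'| <= C by rewrite /C addrAC lerDr addr_ge0.
have [xy|yx] := leP x y.
  by apply: (key h) => //; apply: hd; move: yd; rewrite ler_norml; lra.
by apply: (key h') => //; apply: hd'; move: yd'; rewrite ler_norml; lra.
Unshelve. all: by end_near. Qed.

Lemma rslopeD f g x h k : has_rslope f x h -> has_rslope g x k ->
  has_rslope (fun y => f y + g y) x (h + k).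
Proof.
move=> [d d0 hd] [e e0 he]; exists (Num.min d e); first by rewrite lt_min d0.
move=> y /andP[xy]; rewrite -lerBlDl le_min !lerBlDl => /andP[yd ye].
by rewrite hd ?xy // he ?xy //; ring.
Qed.

Lemma lslopeD f g x h k : has_lslope f x h -> has_lslope g x k ->
  has_lslope (fun y => f y + g y) x (h + k).
Proof.
move=> [d d0 hd] [e e0 he]; exists (Num.min d e); first by rewrite lt_min d0.
move=> y /andP[yd yx]; have := yd; rewrite lerBlDr -lerBlDl le_min !lerBlDl -!lerBlDr => /andP[yd' ye].
by rewrite hd ?yd' // he ?ye //; ring.
Qed.

Lemma rslope_affine a s c x : has_rslope (fun y => a + s * (y - c)) x s.
Proof. by exists 1 => // y _; ring. Qed.

Lemma lslope_affine a s c x : has_lslope (fun y => a + s * (y - c)) x s.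
Proof. by exists 1 => // y _; ring. Qed.

Lemma rslope_kink (J t x : R) :
  has_rslope (fun y => J * Num.max 0 (y - t)) x (if t <= x then J else 0).
Proof.
case: leP => tx.
  exists 1 => // y /andP[xy _].
  by rewrite !max_r ?subr_ge0 //; [ring | exact: le_trans xy].
exists (t - x); first by rewrite subr_gt0.
by move=> y /andP[xy yt]; rewrite !max_l ?subr_le0 ?(ltW tx) //; lra.
Qed.

Lemma lslope_kink (J t x : R) :
  has_lslope (fun y => J * Num.max 0 (y - t)) x (if t < x then J else 0).
Proof.
case: ltP => tx.
  exists (x - t); first by rewrite subr_gt0.
  move=> y /andP[yt _]; rewrite !max_r ?subr_ge0 ?(ltW tx) //; first by ring.
  lra.
exists 1 => // y /andP[_ yx].
by rewrite !max_l ?subr_le0 //; [ring | exact: le_trans tx].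
Qed.

End Slopes.

(** * Functions given by a list of kinks in one period *)

Section PiecewiseLinear.
Variables (R : realType) (p : nat).
Hypothesis hp : prime p.
Implicit Types (g : R -> R) (l : seq (R * R)) (a x y : R).

Let p0 : 0 < p%:R :> R. Proof. by rewrite ltr0n prime_gt0. Qed.
Let p1 : 1 < p%:R :> R. Proof. by rewrite ltr1n prime_gt1. Qed.
Let pB0 : 0 < p%:R - 1 :> R. Proof. by rewrite subr_gt0. Qed.

(* A pair (t, J) is a jump J of the slope at t. The initial slope is determined
   by periodicity: it is p times the final one. *)
Definition initial_slope l : R := - (p%:R / (p%:R - 1)) * \sum_(q <- l) q.2.

Definition pl a l y := a + initial_slope l * (y - 1) +
  \sum_(q <- l) q.2 * Num.max 0 (y - q.1).

Definition right_slope l y := initial_slope l + \sum_(q <- l | q.1 <= y) q.2.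
Definition left_slope l y := initial_slope l + \sum_(q <- l | q.1 < y) q.2.
Definition jump l y := \sum_(q <- l | q.1 == y) q.2.

Lemma rsBls l y : right_slope l y - left_slope l y = jump l y.
Proof.
rewrite /right_slope /left_slope /jump opprD addrACA subrr add0r.
rewrite (bigID (fun q : R * R => q.1 == y)) /= -addrA -[RHS]addr0.
congr (_ + _).
  by apply: eq_bigl => q; case: eqVneq => [->|]; rewrite ?lexx ?andbF ?andbT.
apply/eqP; rewrite subr_eq0; apply/eqP; apply: eq_bigl => q.
by rewrite lt_neqAle andbC.
Qed.

Lemma rslope_pl a l y : has_rslope (pl a l) y (right_slope l y).
Proof.
apply: rslopeD; first exact: rslope_affine.
elim: l => [|q l IHl].
  by exists 1 => // z _; rewrite !big_nil mul0r addr0.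
have := rslopeD (rslope_kink q.2 q.1 y) IHl.
rewrite big_cons; case: ifP => _; rewrite ?add0r => -[d d0 hd]; exists d => // z /hd;
  by rewrite !big_cons.
Qed.

Lemma lslope_pl a l y : has_lslope (pl a l) y (left_slope l y).
Proof.
apply: lslopeD; first exact: lslope_affine.
elim: l => [|q l IHl].
  by exists 1 => // z _; rewrite !big_nil mul0r addr0.
have := lslopeD (lslope_kink q.2 q.1 y) IHl.
rewrite big_cons; case: ifP => _; rewrite ?add0r => -[d d0 hd]; exists d => // z /hd;
  by rewrite !big_cons.
Qed.

Definition kinks l := forall q, q \in l -> fdom p q.1 /\ Hp R p q.2.

Lemma initial_slopeE l : initial_slope l = p%:R * (initial_slope l + \sum_(q <- l) q.2).
Proof. by rewrite /initial_slope; field; rewrite gt_eqF. Qed.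

Lemma pl1 a l : kinks l -> pl a l 1 = a.
Proof.
move=> kl; rewrite /pl subrr mulr0 addr0 big_seq big1 ?addr0 // => q /kl[/andP[q1 _] _].
by rewrite max_l ?mulr0 // subr_le0.
Qed.

(** With this initial slope the terms in p cancel, so that closing up after one period amounts to a
    vanishing moment [sum t J], the degree of the divisor. *)
Lemma plp a l : kinks l -> pl a l p%:R = a - \sum_(q <- l) q.1 * q.2.
Proof.
move=> kl; rewrite /pl.
have -> : \sum_(q <- l) q.2 * Num.max 0 (p%:R - q.1) =
    p%:R * \sum_(q <- l) q.2 - \sum_(q <- l) q.1 * q.2.
  rewrite mulr_sumr -sumrB; rewrite !big_seq; apply: eq_bigr => q /kl[/andP[_ qp] _].
  by rewrite max_r ?subr_ge0 ?(ltW qp) //; ring.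
by rewrite /initial_slope; field; rewrite gt_eqF.
Qed.

Definition scale_invariant g := forall x, 0 < x -> g (p%:R * x) = g x.

Definition represents g l := [/\ kinks l, Hp R p (initial_slope l),
  \sum_(q <- l) q.1 * q.2 = 0, scale_invariant g &
  forall y, 1 <= y <= p%:R -> g y = pl (g 1) l y].

Lemma rslope_scale g x h : scale_invariant g -> 0 < x -> has_rslope g x h -> has_rslope g (p%:R * x) (h / p%:R).
Proof.
move=> pg x0 [d d0 hd]; exists (p%:R * d); first by rewrite mulr_gt0.
move=> y /andP[xy yd]; have -> : y = p%:R * (y / p%:R) by rewrite mulrC divfK // gt_eqF.
have xy' : x <= y / p%:R by rewrite ler_pdivlMr // mulrC.
have yd' : y / p%:R <= x + d by rewrite ler_pdivrMr // mulrC mulrDr.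
have y0 := lt_le_trans x0 xy'.
rewrite (pg _ x0) (pg _ y0) hd ?xy' //; field; by rewrite gt_eqF.
Qed.

Lemma lslope_scale g x h : scale_invariant g -> 0 < x -> has_lslope g x h -> has_lslope g (p%:R * x) (h / p%:R).
Proof.
move=> pg x0 [d d0 hd]; pose e := Num.min d (x / 2).
have e0 : 0 < e by rewrite lt_min d0 divr_gt0.
have [ed ex] : e <= d /\ e < x by rewrite ge_min lexx gt_min; split=> //; apply/orP; right; lra.
exists (p%:R * e); first by rewrite mulr_gt0.
move=> y /andP[xy yd]; have -> : y = p%:R * (y / p%:R) by rewrite mulrC divfK // gt_eqF.
have xy' : y / p%:R <= x by rewrite ler_pdivrMr // mulrC.
have yd' : x - e <= y / p%:R by rewrite ler_pdivlMr // mulrC mulrBr.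
have y0 : 0 < y / p%:R by lra.
rewrite (pg _ x0) (pg _ y0) hd; first by field; rewrite gt_eqF.
by rewrite xy' andbT; lra.
Qed.

Lemma rslope_unscale g x h : scale_invariant g -> 0 < x -> has_rslope g (p%:R * x) h -> has_rslope g x (p%:R * h).
Proof.
move=> pg x0 [d d0 hd]; exists (d / p%:R); first by rewrite divr_gt0.
move=> y /andP[xy yd]; have y0 := lt_le_trans x0 xy.
rewrite -(pg x) // -(pg y) // hd; first by ring.
rewrite ler_pM2l // xy /=; apply: (@le_trans _ _ (p%:R * (x + d / p%:R))).
  by rewrite ler_pM2l.
by rewrite mulrDr mulrCA divff ?mulr1 // gt_eqF.
Qed.

Lemma lslope_unscale g x h : scale_invariant g -> 0 < x -> has_lslope g (p%:R * x) h -> has_lslope g x (p%:R * h).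
Proof.
move=> pg x0 [d d0 hd]; pose e := Num.min (d / p%:R) (x / 2).
have e0 : 0 < e by rewrite lt_min !divr_gt0.
have [ed ex] : e <= d / p%:R /\ e < x by rewrite ge_min lexx gt_min; split=> //; apply/orP; right; lra.
exists e => // y /andP[xy yx]; have y0 : 0 < y by lra.
rewrite -(pg x) // -(pg y) // hd; first by ring.
rewrite ler_pM2l // yx andbT lerBlDr -lerBlDl -mulrBr mulrC -ler_pdivlMr //.
by apply: le_trans ed; lra.
Qed.

Lemma rslope_scaleX g x h k : scale_invariant g -> 0 < x ->
  has_rslope g (x * p%:R ^+ k) h <-> has_rslope g x (h * p%:R ^+ k).
Proof.
move=> pg x0; elim: k h => [|k IHk] h; first by rewrite !expr0 !mulr1.
have xk0 : 0 < x * p%:R ^+ k by rewrite mulr_gt0 // exprn_gt0.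
rewrite exprS mulrCA; split=> [/(rslope_unscale pg xk0)/IHk|].
  by rewrite mulrAC mulrC mulrCA mulrA.
rewrite mulrA -IHk => /(rslope_scale pg xk0); rewrite mulfK // gt_eqF //.
Qed.

Lemma lslope_scaleX g x h k : scale_invariant g -> 0 < x ->
  has_lslope g (x * p%:R ^+ k) h <-> has_lslope g x (h * p%:R ^+ k).
Proof.
move=> pg x0; elim: k h => [|k IHk] h; first by rewrite !expr0 !mulr1.
have xk0 : 0 < x * p%:R ^+ k by rewrite mulr_gt0 // exprn_gt0.
rewrite exprS mulrCA; split=> [/(lslope_unscale pg xk0)/IHk|].
  by rewrite mulrAC mulrC mulrCA mulrA.
rewrite mulrA -IHk => /(lslope_scale pg xk0); rewrite mulfK // gt_eqF //.
Qed.

Lemma order_at_scaleX g x k h h' : scale_invariant g -> 0 < x ->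
  has_rslope g x h -> has_lslope g x h' -> order_at g (x * p%:R ^+ k) = order_at g x.
Proof.
move=> pg x0 rh lh; have pk0 : p%:R ^+ k != 0 :> R by rewrite expf_neq0 // gt_eqF.
have rh' : has_rslope g (x * p%:R ^+ k) (h / p%:R ^+ k) by apply/rslope_scaleX; rewrite ?divfK.
have lh' : has_lslope g (x * p%:R ^+ k) (h' / p%:R ^+ k) by apply/lslope_scaleX; rewrite ?divfK.
rewrite /order_at (rslopeE rh') (lslopeE lh') (rslopeE rh) (lslopeE lh).
by field.
Qed.

Lemma slopes_represents g l y : represents g l -> fdom p y ->
  has_rslope g y (right_slope l y) /\ has_lslope g y (left_slope l y).
Proof.
move=> [kl _ _ pg gE] /andP[y1 yp].
have y0 : 0 < y by apply: lt_le_trans y1.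
have [d d0 hd] := rslope_pl (g 1) l y.
split.
  exists (Num.min d (p%:R - y)); first by rewrite lt_min d0 subr_gt0.
  move=> z /andP[yz]; rewrite -lerBlDl le_min => /andP[zd zp].
  rewrite (gE z) ?(gE y) ?y1 ?(ltW yp) //; last lra.
  by apply: hd; lra.
(* At y = 1 the points on the left leave [[1, p]]: the left slope is read off at p, past all kinks,
   and multiplied by p. *)
have [e e0 he] : has_lslope (pl (g 1) l) p%:R (left_slope l p%:R) by apply: lslope_pl.
have [y1'|] := ltP 1 y.
  have [e' e'0 he'] := lslope_pl (g 1) l y.
  exists (Num.min e' (y - 1)); first by rewrite lt_min e'0 subr_gt0.
  move=> z /andP[zy yz]; have := zy; rewrite lerBlDr -lerBlDl le_min => /andP[ze z1].
  rewrite (gE z) ?(gE y) ?y1 ?(ltW yp) //; last lra.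
  by apply: he'; lra.
rewrite le_eqVlt ltNge y1 orbF => /eqP->.
have -> : left_slope l 1 = p%:R * left_slope l p%:R.
  rewrite /left_slope big_seq_cond big_pred0 ?addr0; last first.
    by move=> q; apply/negP => /andP[/kl[/andP[q1 _] _]]; rewrite ltNge q1.
  rewrite [LHS]initial_slopeE; congr (_ * (_ + _)).
  rewrite [RHS]big_seq_cond [LHS]big_seq; apply: eq_bigl => q.
  by case: (boolP (q \in l)) => // /kl[/andP[_ ->] _].
apply: lslope_unscale => //; rewrite mulr1.
exists (Num.min e (p%:R - 1)); first by rewrite lt_min e0 subr_gt0.
move=> z /andP[zy yz]; have := zy; rewrite lerBlDr -lerBlDl le_min => /andP[ze z1].
rewrite (gE z) ?(gE p%:R) ?(ltW p1) ?lexx //; last lra.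
by apply: he; lra.
Qed.

Lemma order_represents g l y : represents g l -> fdom p y -> order_at g y = y * jump l y.
Proof.
move=> rg fy; have [/rslopeE rE /lslopeE lE] := slopes_represents rg fy.
by rewrite /order_at rE lE rsBls.
Qed.

(** The representative picked by [xget] may lie outside the fundamental domain; it agrees with y up
    to powers of p, under which [order_at] is invariant. *)
Lemma divisor_represents (f : R -> \bar R) l y : represents (fine \o f) l -> fdom p y ->
  divisor_of f (cls hp y) = y * jump l y.
Proof.
move=> rg fy; rewrite -(order_represents rg fy) /divisor_of.
have y0 := fdom_gt0 fy; have [rh lh] := slopes_represents rg fy; have [_ _ _ pg _] := rg.
rewrite set_val_cls ?gt_eqF //.
case: xgetP => [z _ [z0 /(scaleHp_eq hp y0 z0)[m [n e]]]|/(_ y)]; last by case.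
have pn0 i : p%:R ^+ i != 0 :> R by rewrite expf_neq0 // gt_eqF.
rewrite -(order_at_scaleX m pg y0 rh lh) e; apply/esym.
have rz : has_rslope (fine \o f) z (right_slope l y / p%:R ^+ m * p%:R ^+ n).
  by apply/rslope_scaleX => //; rewrite -e; apply/rslope_scaleX; rewrite ?divfK.
have lz : has_lslope (fine \o f) z (left_slope l y / p%:R ^+ m * p%:R ^+ n).
  by apply/lslope_scaleX => //; rewrite -e; apply/lslope_scaleX; rewrite ?divfK.
exact: order_at_scaleX rz lz.
Qed.

End PiecewiseLinear.

(** * Passage between sections and lists of kinks, and the norm *)

Section PiecewiseAffine.
Variables (R : realType) (p : nat).
Hypothesis hp : prime p.
Implicit Types (g : R -> R) (a b x y h : R) (s : seq R) (l : seq (R * R)).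

Let p0 : 0 < p%:R :> R. Proof. by rewrite ltr0n prime_gt0. Qed.
Let p1 : 1 < p%:R :> R. Proof. by rewrite ltr1n prime_gt1. Qed.

Fixpoint affine_pieces g a s : Prop :=
  if s is t :: s' then (exists2 h, Hp R p h & affine_on g a t h) /\ affine_pieces g t s'
  else True.

Lemma affine_piecesP g a s : affine_pieces g a s <->
  forall i, (i < size s)%N -> exists2 h, Hp R p h &
    affine_on g (nth a (a :: s) i) (nth a s i) h.
Proof.
elim: s a => [|t s IHs] a //=; split=> [[ht /IHs hs] [|i] //|hs]; last first.
  split; first exact: (hs 0%N).
  apply/IHs => i si; have [h Hh hh] := hs i.+1 si; exists h => //.
  by rewrite (set_nth_default a) ?[X in affine_on _ _ X](set_nth_default a) //= ltnS ltnW.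
rewrite ltnS => si; have [h Hh hh] := hs i si; exists h => //=.
by rewrite (set_nth_default t) ?[X in affine_on _ _ X](set_nth_default t) //= ltnS ltnW.
Qed.

Lemma affine_pieces_cat g a s1 s2 : affine_pieces g a s1 ->
  affine_pieces g (last a s1) s2 -> affine_pieces g a (s1 ++ s2).
Proof. by elim: s1 a => [|t s1 IHs] a //= [h1 h2] h3; split=> //; apply: IHs. Qed.

Definition pwa g a b := exists2 s, itv_partition a b s & affine_pieces g a s.

Lemma pwa1 g a b h : a < b -> Hp R p h -> affine_on g a b h -> pwa g a b.
Proof.
move=> ab Hh hh; exists [:: b]; first exact: itv_partition1.
by split=> //; exists h.
Qed.

Lemma pwa_trans g a b c : pwa g a b -> pwa g b c -> pwa g a c.
Proof.
move=> [s [ps /eqP left_slope] hs] [u [pu lu] hu]; exists (s ++ u).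
  by split; rewrite ?cat_path ?last_cat ?left_slope ?ps.
by apply: affine_pieces_cat => //; rewrite left_slope.
Qed.

(** Real induction: let c be the supremum of the endpoints reached from a. The left slope at c
    completes a subdivision up to c, and the right slope extends it beyond c unless c = b. *)
Lemma piecewise_affine_slopes g :
  (forall x, 0 < x -> exists2 h, Hp R p h & has_rslope g x h) ->
  (forall x, 0 < x -> exists2 h, Hp R p h & has_lslope g x h) ->
  piecewise_affine p g.
Proof.
move=> gr gl a b a0 ab.
suff [s ps hs] : pwa g a b by exists s => //; apply/affine_piecesP.
pose S := [set y | a < y <= b /\ pwa g a y].
have step c : a <= c -> c < b -> (c = a \/ S c) -> exists2 y, S y & c < y.
  move=> ac cb Sc; have [h Hh [d d0 hd]] := gr c (lt_le_trans a0 ac).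
  pose y := Num.min (c + d) b; have cy : c < y by rewrite lt_min ltrDl d0.
  have pc : pwa g c y.
    apply: (pwa1 cy Hh) => x /andP[cx xy]; apply: hd; rewrite cx /=.
    by move: xy; rewrite le_min => /andP[].
  exists y => //; split; first by rewrite (le_lt_trans ac cy) ge_min lexx orbT.
  by case: Sc => [<-//|[_ pac]]; apply: pwa_trans pc.
have [y0 Sy0 _] := step a (lexx a) ab (or_introl erefl).
have hS : has_sup S by split; [exists y0 | exists b => y [/andP[]]].
set c := sup S.
have y0c : y0 <= c by apply: ub_le_sup => //; exact: hS.2.
have ac : a < c by apply: lt_le_trans y0c; case: Sy0 => /andP[].
have cb : c <= b by apply: ge_sup; [exact: hS.1 | move=> y [/andP[]]].
have Sc : S c.
  split; first by rewrite ac.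
  have [h Hh [d d0 hd]] := gl c (lt_trans a0 ac).
  have [y [/andP[ay yb] py] cy] := sup_adherent d0 hS.
  have : y <= c by apply: ub_le_sup => //; [exact: hS.2 | split; rewrite ?ay].
  rewrite le_eqVlt => /orP[/eqP<-//|yc]; apply: pwa_trans py _.
  apply: (pwa1 yc Hh) => x /andP[yx xc].
  rewrite (hd x); last by rewrite xc andbT (le_trans (ltW cy)).
  by rewrite (hd y); [ring | rewrite (ltW cy) ltW].
move: cb; rewrite le_eqVlt => /orP[/eqP<-|cb]; first by case: Sc.
have [y Sy] := step c (ltW ac) cb (or_intror Sc).
by rewrite ltNge ub_le_sup //; exact: hS.2.
Qed.

Lemma affine_pieces_kinks g a b s : itv_partition a b s -> affine_pieces g a s ->
  exists (s0 : R) l, [/\ Hp R p s0, forall q, q \in l -> a < q.1 <= b /\ Hp R p q.2 &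
    forall y, a <= y <= b ->
      g y = g a + s0 * (y - a) + \sum_(q <- l) q.2 * Num.max 0 (y - q.1)].
Proof.
elim: s a => [|c s IHs] a /=.
  move=> [_ /eqP /= <-] _; exists 0, [::]; split=> //; first exact: (Hp_int _ _ 0).
  by move=> y; rewrite -eq_le => /eqP <-; rewrite big_nil mul0r !addr0.
move=> [/andP[ac pcs] lcs] [[h Hh hh] hs].
have cb : c <= b by apply: itv_partition_le (conj pcs lcs).
have [s0 [l [Hs0 hl gE]]] := IHs c (conj pcs lcs) hs.
exists h, ((c, s0 - h) :: l); split=> //.
  move=> q; rewrite inE => /orP[/eqP-> /=|/hl[/andP[cq qb] Hq]].
    by rewrite ac cb; split=> //; exact: HpB.
  by rewrite (lt_trans ac cq).
move=> y /andP[ay yb]; rewrite big_cons /=.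
have [cy|yc] := leP c y.
  rewrite gE ?cy // max_r ?subr_ge0 // (hh c) ?lexx ?ltW //; ring.
rewrite (hh y) ?ay ?ltW // max_l ?subr_le0 ?ltW // mulr0 add0r.
rewrite big_seq big1 ?addr0 // => q /hl[/andP[cq _] _].
by rewrite max_l ?mulr0 // subr_le0 ltW // (lt_trans yc).
Qed.

Lemma K_represents (f : R -> \bar R) : K p f -> f <> @Kzero R ->
  exists l, represents p (fine \o f) l.
Proof.
case=> [//|[_ ffin fc fpa fper]] _.
set g := fine \o f in fpa *.
have pg : scale_invariant p g by move=> x x0; rewrite /g /= fper.
have [s ps /affine_piecesP hs] := fpa 1 p%:R ltr01 p1.
have [s0 [l0 [Hs0 hl0 gE]]] := affine_pieces_kinks ps hs.
(* A kink at p is invisible on [[1, p]] and is recorded at 1 instead. There the jump [J] is the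
   right slope [s0] minus the left slope, which by scaling is p times the final slope. *)
pose l1 := [seq q <- l0 | q.1 < p%:R].
pose J := s0 - p%:R * (s0 + \sum_(q <- l1) q.2).
have kl1 q : q \in l1 -> 1 < q.1 < p%:R /\ Hp R p q.2.
  by rewrite mem_filter => /andP[qp /hl0[/andP[q1 _] Hq]]; rewrite q1 qp.
have HJ : Hp R p J.
  apply: HpB => //; apply: HpM => //; first exact: Hp_nat.
  by apply: HpD => //; rewrite big_seq; apply: Hp_sum => // q /kl1[].
pose l := (1, J) :: l1.
have isl : initial_slope p l = s0 - J.
  rewrite /initial_slope /l big_cons /= /J; field; by rewrite gt_eqF // subr_gt0.
have gE1 y : 1 <= y <= p%:R -> g y = pl p (g 1) l y.
  move=> y1p; rewrite gE // /pl isl /l big_cons /= max_r ?subr_ge0; last by case/andP: y1p.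
  have -> : \sum_(q <- l0) q.2 * Num.max 0 (y - q.1) = \sum_(q <- l1) q.2 * Num.max 0 (y - q.1).
    rewrite [RHS]big_filter [RHS]big_mkcond; apply: eq_bigr => q _.
    case: ltP => // pq; rewrite max_l ?mulr0 // subr_le0; apply: le_trans pq.
    by case/andP: y1p.
  ring.
have kl : kinks p l.
  move=> q; rewrite inE => /orP[/eqP->|/kl1[/andP[q1 qp] Hq]]; rewrite /fdom /=.
    by rewrite lexx p1.
  by rewrite ltW.
exists l; split=> //; first by rewrite isl; exact: HpB.
have := gE1 p%:R; rewrite lexx (ltW p1) plp // -{1}[p%:R]mulr1 pg // => /(_ isT)/eqP.
by rewrite -subr_eq0 opprB addrCA subrr addr0 => /eqP.
Qed.

Lemma represents_slopes g l x : represents p g l -> 0 < x -> exists y k j,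
  [/\ fdom p y, x * p%:R ^+ j = y * p%:R ^+ k,
   has_rslope g x (right_slope p l y * p%:R ^+ j / p%:R ^+ k) &
   has_lslope g x (left_slope p l y * p%:R ^+ j / p%:R ^+ k)].
Proof.
move=> rg x0; have [y [k [j [fy e]]]] := fdom_exists hp x0.
have y0 := fdom_gt0 fy; have [rh lh] := slopes_represents hp rg fy; have [_ _ _ pg _] := rg.
have pn0 i : p%:R ^+ i != 0 :> R by rewrite expf_neq0 // gt_eqF.
exists y, k, j; split=> //; rewrite mulrAC.
  by apply/rslope_scaleX => //; rewrite e; apply/rslope_scaleX; rewrite ?divfK.
by apply/lslope_scaleX => //; rewrite e; apply/lslope_scaleX; rewrite ?divfK.
Qed.

Definition to_fdom x : R := xget 1 [set y | fdom p y /\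
  exists k j, x * p%:R ^+ j = y * p%:R ^+ k].

Lemma to_fdomP x : 0 < x -> fdom p (to_fdom x) /\
  exists k j, x * p%:R ^+ j = to_fdom x * p%:R ^+ k.
Proof.
move=> x0; rewrite /to_fdom; case: xgetP => [y _ //|].
by have [y [k [j [fy e]]]] := fdom_exists hp x0 => /(_ y); case; split=> //; exists k, j.
Qed.

Lemma to_fdom_eq x y k j : 0 < x -> fdom p y -> x * p%:R ^+ j = y * p%:R ^+ k -> to_fdom x = y.
Proof.
move=> x0 fy e; have [fx [k' [j' e']]] := to_fdomP x0.
apply: (fdom_uniq hp (m := k' + j) (n := k + j')) => //.
by rewrite !exprD !mulrA -e -e' mulrAC.
Qed.

Definition periodic_section a l (x : R) : \bar R :=
  if x <= 0 then -oo%E else (pl p a l (to_fdom x))%:E.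

Lemma periodic_section_fdom a l y : fdom p y -> fine (periodic_section a l y) = pl p a l y.
Proof.
move=> fy; have y0 := fdom_gt0 fy.
rewrite /periodic_section leNgt y0 /= (@to_fdom_eq _ y 0 0) //.
Qed.

Lemma periodic_section_represents a l : kinks p l -> Hp R p (initial_slope p l) ->
  \sum_(q <- l) q.1 * q.2 = 0 -> represents p (fine \o periodic_section a l) l.
Proof.
move=> kl hi l0.
have per x : 0 < x -> fine (periodic_section a l (p%:R * x)) = fine (periodic_section a l x).
  move=> x0; have px0 : 0 < p%:R * x by rewrite mulr_gt0.
  rewrite /periodic_section !leNgt x0 px0 /=.
  have [fx [k [j e]]] := to_fdomP x0; congr pl.
  by apply: (@to_fdom_eq _ _ k.+1 j) => //; rewrite -mulrA e exprS mulrCA.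
split=> // y /andP[y1 yp] /=.
rewrite (periodic_section_fdom a l (y := 1)) ?pl1 /fdom ?lexx //.
move: yp; rewrite le_eqVlt => /orP[/eqP->|yp]; last first.
  by rewrite periodic_section_fdom // /fdom y1.
rewrite -[X in periodic_section _ _ X]mulr1 per // periodic_section_fdom ?/fdom ?lexx //.
by rewrite pl1 // plp // l0 subr0.
Qed.

Lemma periodic_section_K a l : kinks p l -> Hp R p (initial_slope p l) ->
  \sum_(q <- l) q.1 * q.2 = 0 -> K p (periodic_section a l).
Proof.
move=> kl hi l0; have rep := periodic_section_represents a kl hi l0.
set g := fine \o _ in rep.
have sl x : 0 < x -> exists h h', [/\ Hp R p h, Hp R p h', has_rslope g x h & has_lslope g x h'].
  move=> x0; have [y [k [j [fy e rh lh]]]] := represents_slopes rep x0.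
  exists (right_slope p l y * p%:R ^+ j / p%:R ^+ k), (left_slope p l y * p%:R ^+ j / p%:R ^+ k).
  have hr : Hp R p (p%:R ^+ j / p%:R ^+ k).
    by apply: HpM => //; [rewrite -natrX; exact: Hp_nat | exact: Hp_pinv].
  split=> //; rewrite -mulrA; apply: HpM => //; apply: HpD => //.
    by rewrite big_seq_cond; apply: Hp_sum => // q /andP[/kl[]].
  by rewrite big_seq_cond; apply: Hp_sum => // q /andP[/kl[]].
right; split.
- by move=> x x0; rewrite /periodic_section x0.
- by move=> x x0; rewrite /periodic_section leNgt x0.
- move=> x; rewrite inE /Rpos /= in_itv /= andbT => /sl[h [h' [_ _ rh lh]]].
  exact: rslope_continuous rh lh.
- by apply: piecewise_affine_slopes => x /sl[h [h' [Hh Hh' rh lh]]]; [exists h|exists h'].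
- move=> x x0; have [_ _ _ per _] := rep; have := per x x0; rewrite /g /=.
  have px0 : 0 < p%:R * x by rewrite mulr_gt0.
  by rewrite /periodic_section !leNgt x0 px0 /= => ->.
Qed.

Lemma Knorm_le (f : R -> \bar R) l n : represents p (fine \o f) l ->
  (forall y, fdom p y -> exists2 u : int, right_slope p l y * p%:R ^+ n = u%:~R &
     exists v : int, left_slope p l y * p%:R ^+ n = v%:~R) ->
  (Knorm p f <= (p%:R ^+ n)%:E)%E.
Proof.
move=> rg hl; rewrite /Knorm; case: ifP => _; first by rewrite lee_fin exprn_ge0 // ltW.
apply: ge_ereal_sup => _ [x Rx <-].
have x0 : 0 < x by move: Rx; rewrite /Rpos /= in_itv /= andbT.
have [y [k [j [fy e /rslopeE-> /lslopeE->]]]] := represents_slopes rg x0.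
have [u ru [v lv]] := hl y fy.
have pn0 i : 0 < p%:R ^+ i :> R by rewrite exprn_gt0.
(* The slope at x is the slope at y times [p^(j-k)], so its p-adic absolute value is at most
   [p^(n+k-j)]; since x is [y p^(k-j)], the bound follows from y >= 1. *)
have xE : p%:R ^+ (n + k) / p%:R ^+ j <= p%:R ^+ n * x.
  rewrite exprD -mulrA ler_pM2l // ler_pdivrMr // e.
  by apply: ler_peMl; [exact: ltW | case/andP: fy].
have key h (w : int) : h * p%:R ^+ n = w%:~R ->
    padic_abs p (h * p%:R ^+ j / p%:R ^+ k) / x <= p%:R ^+ n.
  move=> hw; rewrite ler_pdivrMr //; apply: le_trans xE.
  apply: (@padic_abs_le _ _ hp _ _ _ w).
  rewrite exprD mulrA -hw.
  by rewrite -!mulrA (mulrCA _ (p%:R ^+ n)) mulVf ?gt_eqF // mulr1 (mulrC _ (p%:R ^+ n)).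
by rewrite lee_fin ge_max (key _ u) // (key _ v).
Qed.

Lemma Knorm_slopes (f : R -> \bar R) l n y : f <> @Kzero R -> represents p (fine \o f) l ->
  (Knorm p f <= (p%:R ^+ n)%:E)%E -> fdom p y ->
  exists u : int, jump l y * p%:R ^+ n = u%:~R.
Proof.
move=> f0 rg nf fy; have y0 := fdom_gt0 fy.
have [/rslopeE re /lslopeE le] := slopes_represents hp rg fy.
have : ((Num.max (padic_abs p (right_slope p l y) / y) (padic_abs p (left_slope p l y) / y))%:E
    <= (p%:R ^+ n)%:E)%E.
  apply: le_trans nf; rewrite /Knorm; case: ifPn => [/asboolP //|_].
  apply: ereal_sup_ubound; exists y; first by rewrite /Rpos /= in_itv /= y0.
  by rewrite re le.
rewrite lee_fin ge_max !ler_pdivrMr // => /andP[hr hl].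
have [kl hi _ _ _] := rg.
have yn : p%:R ^+ n * y < p%:R ^+ n.+1.
  by rewrite exprSr ltr_pM2l ?exprn_gt0 //; case/andP: fy.
have [u ru] : exists u : int, right_slope p l y * p%:R ^+ n = u%:~R.
  apply: padic_abs_denom (le_lt_trans hr yn) => //.
  by apply: HpD => //; rewrite big_seq_cond; apply: Hp_sum => // q /andP[/kl[]].
have [v lv] : exists u : int, left_slope p l y * p%:R ^+ n = u%:~R.
  apply: padic_abs_denom (le_lt_trans hl yn) => //.
  by apply: HpD => //; rewrite big_seq_cond; apply: Hp_sum => // q /andP[/kl[]].
by exists (u - v); rewrite rmorphB /= -ru -lv -mulrBl rsBls.
Qed.

End PiecewiseAffine.

(** * Degree and number of kinks *)

Lemma max0_dist (R : realDomainType) (a b : R) : `|Num.max 0 a - Num.max 0 b| <= `|a - b|.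
Proof.
case: (leP 0 a) => ha; case: (leP 0 b) => hb //.
- by rewrite subr0 (ger0_norm ha); have := ler_norm (a - b); lra.
- by rewrite sub0r normrN (ger0_norm hb) distrC; have := ler_norm (b - a); lra.
- by rewrite subrr normr0.
Qed.

Section Degree.
Variables (R : realType) (p : nat).
Hypothesis hp : prime p.
Implicit Types (D : Cp R p -> R) (g : R -> R) (l : seq (R * R)) (u w : seq R).

Let p0 : 0 < p%:R :> R. Proof. by rewrite ltr0n prime_gt0. Qed.
Let p1 : 1 < p%:R :> R. Proof. by rewrite ltr1n prime_gt1. Qed.

Definition supports u D := [/\ uniq u, forall t, t \in u -> fdom p t &
  forall t, fdom p t -> t \notin u -> D (cls hp t) = 0].

Lemma Div_supports D : Div D -> exists u, supports u D.
Proof.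
move=> [_ /finite_seqP[s sE]].
have /choice[t ht] : forall H : Cp R p, exists t, fdom p t /\ H = cls hp t.
  by move=> H; have [t ft Ht] := cls_surj hp H; exists t.
exists (undup (map t s)); split; first exact: undup_uniq.
  by move=> x; rewrite mem_undup => /mapP[H _ ->]; case: (ht H).
move=> x fx; rewrite mem_undup; apply: contraNeq => Dx.
have : [set H | D H != 0] (cls hp x) by [].
rewrite sE /= => xs; apply/mapP; exists (cls hp x) => //.
by have [ft /cls_inj] := ht (cls hp x); apply.
Qed.

Lemma deg_supports D u : supports u D -> deg D = \sum_(t <- u) D (cls hp t).
Proof.
move=> [uu fu u0]; rewrite /deg (fsbigE (map (cls hp) u)) //; first last.
- move=> H _ Hu; have [t ft Ht] := cls_surj hp H.
  rewrite Ht; apply: u0 => //; apply: contra Hu => tu.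
  by rewrite Ht map_f.
- rewrite map_inj_in_uniq // => x y xu yu; apply: cls_inj; exact: fu.
by rewrite big_map; apply: eq_bigl => t; rewrite in_setT.
Qed.

Lemma supports_cat D u v : supports u D -> (forall t, t \in v -> fdom p t) ->
  supports (undup (u ++ v)) D.
Proof.
move=> [uu fu u0] fv; split; first exact: undup_uniq.
  by move=> t; rewrite mem_undup mem_cat => /orP[/fu|/fv].
by move=> t ft; rewrite mem_undup mem_cat negb_or => /andP[tu _]; apply: u0.
Qed.

Lemma jump_notin l t : t \notin [seq q.1 | q <- l] -> jump l t = 0.
Proof.
move=> tl; rewrite /jump big_seq_cond big1 // => q /andP[ql /eqP e].
by case/negP: tl; rewrite -e map_f.
Qed.

(** A list of kinks may repeat a point or contain entries that cancel; sums are regrouped by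
    position, so that only total jumps matter. *)
Lemma sum_jump l w (P : pred R) (F : R -> R) : uniq w ->
  {subset [seq q.1 | q <- l] <= w} ->
  \sum_(q <- l | P q.1) q.2 * F q.1 = \sum_(t <- w | P t) jump l t * F t.
Proof.
move=> uw lw.
transitivity (\sum_(q <- l) \sum_(t <- w) if P t && (q.1 == t) then q.2 * F t else 0).
  rewrite big_mkcond big_seq [RHS]big_seq; apply: eq_bigr => q ql.
  have qw : q.1 \in w by apply: lw; rewrite map_f.
  rewrite (bigD1_seq q.1) //= eqxx andbT big1 ?addr0 // => t tq.
  by rewrite eq_sym (negPf tq) andbF.
rewrite exchange_big /= [RHS]big_mkcond; apply: eq_bigr => t _.
case: (P t) => /=; last by rewrite big1.
by rewrite /jump mulr_suml [RHS]big_mkcond.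
Qed.

Lemma Hp_rs l y : kinks p l -> Hp R p (initial_slope p l) -> Hp R p (right_slope p l y).
Proof.
move=> kl hi; apply: HpD => //; rewrite big_seq_cond.
by apply: Hp_sum => // q /andP[/kl[]].
Qed.

(** Between rational points this makes the change of value rational, the slope being in [H_p]. *)
Lemma pl_no_kink a l x y : x <= y ->
  (forall t, x < t < y -> jump l t = 0) -> pl p a l y - pl p a l x = right_slope p l x * (y - x).
Proof.
move=> xy nk; pose w := undup [seq q.1 | q <- l].
have uw : uniq w by apply: undup_uniq.
have lw : {subset [seq q.1 | q <- l] <= w} by move=> t; rewrite mem_undup.
have E z : \sum_(q <- l) q.2 * Num.max 0 (z - q.1) = \sum_(t <- w) jump l t * Num.max 0 (z - t).
  exact: (@sum_jump l w predT (fun t => Num.max 0 (z - t)) uw lw).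
have Er : \sum_(q <- l | q.1 <= x) q.2 = \sum_(t <- w | t <= x) jump l t.
  transitivity (\sum_(q <- l | q.1 <= x) q.2 * 1); first by apply: eq_bigr => q _; rewrite mulr1.
  rewrite (@sum_jump l w (fun t => t <= x) (fun=> 1) uw lw).
  by apply: eq_bigr => t _; rewrite mulr1.
rewrite /right_slope Er /pl !E mulrDl.
have -> : (\sum_(t <- w | t <= x) jump l t) * (y - x) =
    \sum_(t <- w) jump l t * Num.max 0 (y - t) - \sum_(t <- w) jump l t * Num.max 0 (x - t).
  rewrite mulr_suml big_mkcond -sumrB; apply: eq_bigr => t _.
  case: leP => [tx|xt].
    by rewrite !max_r ?subr_ge0 ?(le_trans tx) //; ring.
  have -> : Num.max 0 (x - t) = 0 by rewrite max_l // subr_le0 ltW.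
  rewrite mulr0 subr0.
  have [ty|yt] := ltP t y; first by rewrite nk ?mul0r // xt.
  by rewrite max_l ?mulr0 // subr_le0.
ring.
Qed.

(** The constant 3 is 2 for the initial slope, as [p / (p - 1) <= 2], plus 1 for the hinge
    functions. *)
Lemma pl_lipschitz a l w x y : 1 <= x <= p%:R -> 1 <= y <= p%:R -> uniq w ->
  {subset [seq q.1 | q <- l] <= w} ->
  `|pl p a l x - pl p a l y| <= 3 * (\sum_(t <- w) `|jump l t|) * `|x - y|.
Proof.
move=> xp yp uw lw; set S := \sum_(t <- w) _.
have E z : \sum_(q <- l) q.2 * Num.max 0 (z - q.1) = \sum_(t <- w) jump l t * Num.max 0 (z - t).
  exact: (@sum_jump l w predT (fun t => Num.max 0 (z - t)) uw lw).
have Er : \sum_(q <- l) q.2 = \sum_(t <- w) jump l t.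
  transitivity (\sum_(q <- l) q.2 * 1); first by apply: eq_bigr => q _; rewrite mulr1.
  rewrite (@sum_jump l w predT (fun=> 1) uw lw).
  by apply: eq_bigr => t _; rewrite mulr1.
have hi : `|initial_slope p l| <= 2 * S.
  rewrite /initial_slope Er normrM normrN; apply: ler_pM => //; last exact: ler_norm_sum.
  rewrite ger0_norm ?divr_ge0 ?subr_ge0 ?(ltW p1) ?(ltW p0) // ler_pdivrMr ?subr_gt0 //.
  have : 2 <= p%:R :> R by rewrite ler_nat prime_gt1.
  lra.
rewrite /pl !E.
have -> : a + initial_slope p l * (x - 1) + \sum_(t <- w) jump l t * Num.max 0 (x - t) -
    (a + initial_slope p l * (y - 1) + \sum_(t <- w) jump l t * Num.max 0 (y - t)) =
    initial_slope p l * (x - y) + \sum_(t <- w) jump l t * (Num.max 0 (x - t) - Num.max 0 (y - t)).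
  under [in RHS]eq_bigr do rewrite mulrBr.
  rewrite sumrB; ring.
have -> : 3 * S * `|x - y| = 2 * S * `|x - y| + S * `|x - y| by ring.
apply: le_trans (ler_normD _ _) _; apply: lerD.
  by rewrite normrM ler_wpM2r.
apply: le_trans (ler_norm_sum _ _ _) _; rewrite mulr_suml; apply: ler_sum => t _.
rewrite normrM ler_wpM2l //.
apply: le_trans (max0_dist _ _) _.
by rewrite opprB addrA subrK.
Qed.

Section Bounds.
Variables (D : Cp R p -> R) (u : seq R) (f : R -> \bar R) (l : seq (R * R)).
Hypothesis uD : supports u D.
Hypotheses (fD : H0 D f) (f0 : f <> @Kzero R) (fl : represents p (fine \o f) l).

Let w := undup (u ++ [seq q.1 | q <- l]).

Let lw : {subset [seq q.1 | q <- l] <= w}.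
Proof. by move=> t tl; rewrite mem_undup mem_cat tl orbT. Qed.

Let kfdom t : t \in [seq q.1 | q <- l] -> fdom p t.
Proof. by have [kl _ _ _ _] := fl; move=> /mapP[q /kl[fq _] ->]. Qed.

Let wD : supports w D.
Proof. exact: supports_cat uD kfdom. Qed.

Lemma sum_moment : \sum_(t <- w) t * jump l t = 0.
Proof.
have [_ _ E _ _] := fl; have [uw _ _] := wD; rewrite -[RHS]E.
transitivity (\sum_(t <- w) jump l t * t); first by apply: eq_bigr => t _; rewrite mulrC.
transitivity (\sum_(q <- l) q.2 * q.1); last by apply: eq_bigr => q _; rewrite mulrC.
by apply/esym; exact: (@sum_jump l w predT id).
Qed.

Lemma H0_jump_ge0 t : fdom p t -> 0 <= D (cls hp t) + t * jump l t.
Proof.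
by move=> ft; have [_ [//|/(_ (cls hp t))]] := fD; rewrite (divisor_represents hp fl ft).
Qed.

Lemma deg_jump : \sum_(t <- w) (D (cls hp t) + t * jump l t) = deg D.
Proof.
rewrite big_split /= -(deg_supports wD) -[RHS]addr0; congr (_ + _).
exact: sum_moment.
Qed.

Lemma H0_deg_ge0 : 0 <= deg D.
Proof.
rewrite -deg_jump big_seq; apply: sumr_ge0 => t tw; apply: H0_jump_ge0.
by case: wD => _ + _; apply.
Qed.

(** The constant depends on D alone. Since [t J >= - D] at each point, [|t J| <= t J + 2 |D|];
    summing, the moments cancel and the total jump is at most [2 sum |D|]. *)
Lemma H0_lipschitz x y : 1 <= x <= p%:R -> 1 <= y <= p%:R ->
  `|fine (f x) - fine (f y)| <= 6 * (\sum_(t <- u) `|D (cls hp t)|) * `|x - y|.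
Proof.
move=> xp yp; have [kl _ E _ gE] := fl; have [uw fw w0] := wD.
rewrite -![fine (f _)]/((fine \o f) _) (gE x xp) (gE y yp).
apply: le_trans (@pl_lipschitz _ _ w _ _ xp yp uw lw) _.
rewrite ler_wpM2r // (_ : 6 = 3 * 2 :> R) -?mulrA ?ler_wpM2l //; last by ring.
have -> : \sum_(t <- u) `|D (cls hp t)| = \sum_(t <- w) `|D (cls hp t)|.
  have [uu fu u0] := uD.
  rewrite [RHS](bigID (fun t => t \in u)) /= [X in _ = _ + X]big_seq_cond.
  rewrite [X in _ = _ + X]big1 ?addr0; last first.
    by move=> t /andP[tw /u0 ->]; rewrite ?normr0 //; exact: fw.
  rewrite -[RHS]big_filter; apply: perm_big; apply: uniq_perm => //; first exact: filter_uniq.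
  by move=> t; rewrite mem_filter mem_undup mem_cat; case: (t \in u).
have -> : 2 * \sum_(t <- w) `|D (cls hp t)| =
    \sum_(t <- w) (t * jump l t + 2 * `|D (cls hp t)|).
  by rewrite big_split /= sum_moment add0r mulr_sumr.
rewrite !big_seq; apply: ler_sum => t tw; have ft := fw t tw.
have t1 : 1 <= t by case/andP: ft.
have jt : `|jump l t| <= `|t * jump l t|.
  by rewrite normrM ler_peMl // ger0_norm // (le_trans _ t1).
apply: le_trans jt _; have := H0_jump_ge0 ft.
have := ler_norm (D (cls hp t)); have := normr_ge0 (D (cls hp t)).
set d := `|_|; set v := t * _; set e := D _ => d0 ed dv.
by have [v0|v0] := leP 0 v; [rewrite ger0_norm | rewrite ltr0_norm]; lra.
Qed.

(** Off [u] effectivity makes the jumps positive, and t >= 1 keeps [t J] at least [p^-n]. Points of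
    [u], where D may cancel a jump, are merely counted. *)
Lemma H0_kinks_count n Y : (Knorm p f <= (p%:R ^+ n)%:E)%E -> uniq Y ->
  (forall t, t \in Y -> fdom p t /\ jump l t != 0) ->
  (size Y)%:R <= p%:R ^+ n * deg D + (size u)%:R.
Proof.
move=> nf uY YP; have [uw fw w0] := wD; have [uu fu u0] := uD.
have pn0 : 0 < p%:R ^+ n :> R by rewrite exprn_gt0.
pose Z := [seq t <- Y | t \notin u].
have sY : (size Y <= size Z + size u)%N.
  rewrite -(count_predC (fun t => t \in u)) addnC leq_add //.
    by rewrite /Z size_filter.
  rewrite -size_filter uniq_leq_size //; first exact: filter_uniq.
  by move=> t; rewrite mem_filter => /andP[].
apply: (@le_trans _ _ ((size Z)%:R + (size u)%:R)); first by rewrite -natrD ler_nat.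
rewrite lerD2r mulrC -ler_pdivrMr // -deg_jump.
have uZ : uniq Z by apply: filter_uniq.
have Zw : {subset Z <= w}.
  move=> t; rewrite mem_filter => /andP[_ /YP[_]]; apply: contraNT => tw.
  by apply/eqP/jump_notin; apply: contra tw; exact: lw.
rewrite (bigID (fun t => t \in Z)) /=.
apply: (@le_trans _ _ (\sum_(t <- w | t \in Z) (D (cls hp t) + t * jump l t))); last first.
  rewrite lerDl big_seq_cond; apply: sumr_ge0 => t /andP[tw _].
  by apply: H0_jump_ge0; apply: fw.
rewrite -big_filter.
have -> : \sum_(t <- [seq i <- w | i \in Z]) (D (cls hp t) + t * jump l t) =
    \sum_(t <- Z) (D (cls hp t) + t * jump l t).
  apply: perm_big; apply: uniq_perm => //; first exact: filter_uniq.
  by move=> t; rewrite mem_filter; apply/andb_idr/Zw.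
have -> : (size Z)%:R / p%:R ^+ n = \sum_(t <- Z) (p%:R ^+ n)^-1 :> R.
  by rewrite big_const_seq count_predT iter_addr_0 mulr_natl.
rewrite !big_seq; apply: ler_sum => t; rewrite mem_filter => /andP[tu /YP[ft jt]].
have := H0_jump_ge0 ft; rewrite u0 // add0r.
have t0 := fdom_gt0 ft; have t1 : 1 <= t by case/andP: ft.
rewrite pmulr_rge0 // => j0; have jp : 0 < jump l t by rewrite lt_neqAle eq_sym jt.
have [v jv] := Knorm_slopes hp f0 fl nf ft.
have v0 : 0 < v by rewrite -(ltr0z R) -jv mulr_gt0.
apply: (@le_trans _ _ (jump l t)); last by rewrite ler_peMl.
rewrite -[X in X <= _]mul1r ler_pdivrMr // jv -[1]/(1%:~R) ler_int.
by case: v v0 {jv} => // -[].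
Qed.

End Bounds.

End Degree.

(** * Upper bound *)

Section Space.
Variables (R : realType) (p : nat) (D : Cp R p -> R) (rho : R).
Local Notation T := (H0le_space D rho).

Definition ev (x : R) (f : T) : R := expK (set_val (f : H0le D rho)) x.

Lemma continuous_ev (x : R) : 0 < x -> continuous (ev x : T -> R).
Proof.
move=> x0 f A /nbhs_ballP[e e0 eA].
have h : nbhs (expK (set_val (f : H0le D rho)) : {uniform` @Rpos R -> R})
    [set g | A (g x)].
  apply/uniform_nbhs; exists [set xy | ball xy.1 e xy.2]; split; first exact: (entourage_ball _ (PosNum e0)).
  by move=> g /(_ x) hg; apply: eA; apply: hg; rewrite /Rpos /= in_itv /= x0.
exact: (@initial_continuous _ _ (fun f : H0le D rho => expK (set_val f)) f _ h).
Qed.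

Lemma open_space_ev (U : set T) f : open U -> U f -> exists2 e : R, 0 < e &
  forall g, (forall x : R, 0 < x -> `|ev x f - ev x g| < e) -> U g.
Proof.
move=> [W oW <-] Wf.
have : nbhs (expK (set_val (f : H0le D rho)) : {uniform` @Rpos R -> R}) W.
  exact: open_nbhs_nbhs.
move=> /uniform_nbhs[E []]; rewrite -entourage_ballE => -[e e0 eE] EW.
exists e => // g hg; apply: EW => x; rewrite /Rpos /= in_itv /= andbT => x0.
by apply: eE; apply: hg.
Qed.

End Space.

Lemma expR_dist (R : realType) (M a b : R) : a <= M -> b <= M ->
  `|expR a - expR b| <= expR M * `|a - b|.
Proof.
wlog ab : a b / b <= a => [W aM bM|].
  have [ab|ab] := leP b a; first exact: W.
  by rewrite distrC (distrC a); apply: W => //; apply: ltW.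
move=> aM _; rewrite !ger0_norm ?subr_ge0 ?ler_expR //.
apply: (@le_trans _ _ (expR a * (a - b))); last first.
  by rewrite ler_wpM2r ?subr_ge0 // ler_expR.
have := expR_ge1Dx (b - a); rewrite expRB => h.
have e0 := expR_gt0 a; have : expR a * (1 + (b - a)) <= expR a * (expR b / expR a).
  by rewrite ler_pM2l.
rewrite (mulrC _ (_ / _)) divfK ?gt_eqF // => h2; lra.
Qed.

Lemma pick_between (R : realType) (P : R -> Prop) x s : path <%R x s ->
  (forall a b, a \in x :: s -> b \in x :: s -> a < b -> exists2 t, a < t < b & P t) ->
  exists Y, [/\ size Y = size s, path <%R x Y &
    forall t, t \in Y -> x < t < last x s /\ P t].
Proof.
elim: s x => [|y s IHs] x /=; first by exists [::].
move=> /andP[xy ps] h.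
have sub : {subset y :: s <= x :: y :: s} by move=> z zI; rewrite in_cons zI orbT.
have [Y [sY pY YP]] := IHs y ps (fun a b aI bI => h a b (sub a aI) (sub b bI)).
have [t /andP[xt ty] Pt] := h x y (mem_head _ _) (sub y (mem_head _ _)) xy.
have yl : y <= last y s.
  have /allP h' := order_path_min lt_trans ps.
  by have := mem_last y s; rewrite inE => /orP[/eqP->|/h'/ltW].
exists (t :: Y); split=> /=; first by rewrite sY.
  rewrite xt; case: Y pY {sY YP} => //= z Y /andP[yz ->]; by rewrite (lt_trans ty yz).
move=> z; rewrite inE => /orP[/eqP->|/YP[/andP[yz zl] Pz]].
  by rewrite xt (lt_le_trans ty yl).
by rewrite (lt_trans xy yz) zl.
Qed.

Section UpperBound.
Variables (R : realType) (p : nat).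
Hypothesis hp : prime p.
Variables (D : Cp R p -> R) (u : seq R) (n N : nat).
Hypotheses (uD : supports hp u D) (N0 : (0 < N)%N).
Hypothesis (hN : 0 <= deg D -> p%:R ^+ n * deg D + (size u).+1%:R < N%:R).

Local Notation rho := (p%:R ^+ n : R).
Local Notation T := (H0le_space D rho).
Let p0 : 0 < p%:R :> R. Proof. by rewrite ltr0n prime_gt0. Qed.
Let p1 : 1 < p%:R :> R. Proof. by rewrite ltr1n prime_gt1. Qed.

Definition T_val (f : T) : R -> \bar R := set_val (f : H0le D rho).

Lemma T_cases (f : T) : T_val f = @Kzero R \/
  exists l, [/\ T_val f <> @Kzero R, represents p (fine \o T_val f) l,
    H0 D (T_val f), (Knorm p (T_val f) <= (p%:R ^+ n)%:E)%E &
    forall x, 0 < x -> T_val f x \is a fin_num].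
Proof.
have [fz|fz] := pselect (T_val f = @Kzero R); [by left | right].
have [HfD Hn] := set_valP (f : H0le D rho).
have [Kf _] := HfD; have [l rl] := K_represents hp Kf fz.
by exists l; split=> //; case: Kf => [/fz|[]].
Qed.

Lemma ev_Kzero (f : T) x : T_val f = @Kzero R -> ev x f = 0.
Proof. by move=> fz; rewrite /ev /expK -/(T_val f) fz /=. Qed.

Lemma ev_fin (f : T) x : T_val f x \is a fin_num -> ev x f = expR (fine (T_val f x)).
Proof. by rewrite /ev /expK -/(T_val f); case: (T_val f x). Qed.

(* The levels used by the i-th family. They lie over pairwise disjoint cosets
   of the rationals, while a section without kinks between two rational points
   changes by a rational number. *)
Definition level (i : nat) (r : rat) : R := i%:R * pi + ratr r.

Lemma level_inj i j (r s q : rat) : level i r - level j s = ratr q -> i = j.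
Proof.
rewrite /level => e; apply/eqP; apply/negPn/negP => ij.
have ij0 : (i%:R - j%:R : R) != 0 by rewrite subr_eq0 eqr_nat.
have pE : pi = ratr ((q - r + s) / (i%:R - j%:R)) :> R.
  rewrite fmorph_div /= !rmorphD !rmorphN /= !ratr_nat -e.
  field => //.
by apply: (@pi_irrationnal R); exists ((q - r + s) / (i%:R - j%:R)).
Qed.


Definition in_period (x : R) := 1 <= x <= p%:R.

(** The condition is vacuous at points outside the period, so that every finite list of triples is
    admissible and [pickle] enumerates the neighbourhoods [basic i k]. *)
Definition atom (i : nat) (c : rat * rat * bool) : set T :=
  [set f | in_period (ratr c.1.1) ->
    if c.2 then ev (ratr c.1.1) f < expR (level i c.1.2)
    else expR (level i c.1.2) < ev (ratr c.1.1) f].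

Definition closed_atom (i : nat) (c : rat * rat * bool) : set T :=
  [set f | in_period (ratr c.1.1) ->
    if c.2 then ev (ratr c.1.1) f <= expR (level i c.1.2)
    else expR (level i c.1.2) <= ev (ratr c.1.1) f].

Definition basic i k : set T :=
  if unpickle k is Some s then \bigcap_(c in [set` (s : seq (rat * rat * bool))]) atom i c else set0.

Definition closed_basic i k : set T :=
  if unpickle k is Some s then
    \bigcap_(c in [set` (s : seq (rat * rat * bool))]) closed_atom i c else set0.

Definition off_levels i : set T := [set f | forall q r : rat, in_period (ratr q) ->
  ev (ratr q) f != expR (level i r)].

Lemma open_atom i c : open (atom i c).
Proof.
have [cp|ncp] := pselect (in_period (ratr c.1.1)); last first.
  by have -> : atom i c = setT; [apply/seteqP; split=> // f _ /ncp | exact: openT].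
have c0 : 0 < ratr c.1.1 :> R by case/andP: cp => /(lt_le_trans ltr01).
have cc := @continuous_ev R p D rho _ c0.
case E : c.2.
  have -> : atom i c = (ev (ratr c.1.1) : T -> R) @^-1` [set x | x < expR (level i c.1.2)].
    by apply/seteqP; split=> f; rewrite /atom /= E //; apply.
  by apply: open_comp; [move=> g _; exact: cc | exact: open_lt].
have -> : atom i c = (ev (ratr c.1.1) : T -> R) @^-1` [set x | expR (level i c.1.2) < x].
  by apply/seteqP; split=> f; rewrite /atom /= E //; apply.
by apply: open_comp; [move=> g _; exact: cc | exact: open_gt].
Qed.

Lemma closed_closed_atom i c : closed (closed_atom i c).
Proof.
have [cp|ncp] := pselect (in_period (ratr c.1.1)); last first.
  by have -> : closed_atom i c = setT; [apply/seteqP; split=> // f _ /ncp | exact: closedT].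
have c0 : 0 < ratr c.1.1 :> R by case/andP: cp => /(lt_le_trans ltr01).
have cc := @continuous_ev R p D rho _ c0.
case E : c.2.
  have -> : closed_atom i c = (ev (ratr c.1.1) : T -> R) @^-1` [set x | x <= expR (level i c.1.2)].
    by apply/seteqP; split=> f; rewrite /closed_atom /= E //; apply.
  by apply: closed_comp; [move=> g _; exact: cc | exact: closed_le].
have -> : closed_atom i c = (ev (ratr c.1.1) : T -> R) @^-1` [set x | expR (level i c.1.2) <= x].
  by apply/seteqP; split=> f; rewrite /closed_atom /= E //; apply.
by apply: closed_comp; [move=> g _; exact: cc | exact: closed_ge].
Qed.

Lemma open_basic i k : open (basic i k).
Proof.
rewrite /basic; case: unpickle => [s|]; last exact: open0.
by apply: finite_bigcap_open => [|c _]; [exact: finite_seq | exact: open_atom].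
Qed.

Lemma closed_closed_basic i k : closed (closed_basic i k).
Proof.
rewrite /closed_basic; case: unpickle => [s|]; last exact: closed0.
by apply: closed_bigI => c _; exact: closed_closed_atom.
Qed.

Lemma basic_closed_basic i k : basic i k `<=` closed_basic i k.
Proof.
rewrite /basic /closed_basic; case: unpickle => // s f h c cs cp.
by have := h c cs cp; case: c.2 => /ltW.
Qed.

Lemma closed_basic_off_levels i k : closed_basic i k `&` off_levels i `<=` basic i k.
Proof.
rewrite /basic /closed_basic; case: unpickle => [s|]; last by move=> f [].
move=> f [h g] c cs cp; have := h c cs cp; have := g c.1.1 c.1.2 cp.
by case: c.2 => e; rewrite lt_neqAle ?[_ == ev _ _]eq_sym e.
Qed.

Lemma off_levels_cover f : exists2 i, (i < N)%N & off_levels i f.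
Proof.
(* The zero section evaluates to 0 and is off all levels, which are exponentials. *)
have [fz|[l [fz rl fD nf ffin]]] := T_cases f.
  exists 0%N => // q r _; rewrite ev_Kzero //.
  by rewrite eq_sym gt_eqF // expR_gt0.
apply: contrapT => no.
pose g := fine \o T_val f.
have /choice[qr hqr] : forall i, exists qr : rat * rat, (i < N)%N ->
    in_period (ratr qr.1) /\ g (ratr qr.1) = level i qr.2.
  move=> i; have [iN|Ni] := ltnP i N; last by exists (0, 0).
  apply: contrapT => h; apply: no; exists i => // q r qp.
  apply/negP => /eqP e; apply: h; exists (q, r) => _; split=> //=.
  have q0 : 0 < ratr q :> R by case/andP: qp => /(lt_le_trans ltr01).
  by move: e; rewrite ev_fin ?ffin // => /expR_inj.
pose Q := [seq ratr (qr i).1 : R | i <- iota 0 N].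
have QP x : x \in Q -> exists i, [/\ (i < N)%N, x = ratr (qr i).1, in_period x & g x = level i (qr i).2].
  move=> /mapP[i]; rewrite mem_iota add0n => /andP[_ iN] ->.
  by have [? ?] := hqr i iN; exists i.
(* Distinct indices give distinct points, since one value lies in only one of the cosets. *)
have uQ : uniq Q.
  rewrite map_inj_in_uniq ?iota_uniq // => i j.
  rewrite !mem_iota !add0n => /andP[_ iN] /andP[_ jN] /= e.
  have [_ gi] := hqr i iN; have [_ gj] := hqr j jN.
  by apply: (@level_inj i j (qr i).2 (qr j).2 0); rewrite -gi -gj e subrr rmorph0.
have pQ : path <%R (head 0 (sort <=%R Q)) (behead (sort <=%R Q)).
  have : sorted <%R (sort <=%R Q) by rewrite lt_sorted_uniq_le sort_uniq uQ sort_le_sorted.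
  by case: (sort _ _).
have sQ : sort <=%R Q = head 0 (sort <=%R Q) :: behead (sort <=%R Q).
  have : (0 < size (sort <=%R Q))%N by rewrite size_sort size_map size_iota.
  by case: (sort _ _).
have [kl hi _ _ gE] : represents p g l := rl.
have gap a b : a \in Q -> b \in Q -> a < b -> exists2 t, a < t < b & jump l t != 0.
  move=> /QP[i [iN ai ap ga]] /QP[j [jN bj bp gb]] ab; apply: contrapT => nk.
  have nk' t : a < t < b -> jump l t = 0.
    by move=> abt; apply/eqP/negPn/negP => jt; apply: nk; exists t.
  have := pl_no_kink p (g 1) (ltW ab) nk'.
  rewrite -!gE // ga gb; have [h ->] := Hp_rat (Hp_rs hp a kl hi).
  rewrite bj ai -rmorphB -rmorphM => /level_inj ji.
  by move: ab; rewrite ai bj ji ltxx.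
set x := head 0 _ in pQ sQ *; set s := behead _ in pQ sQ *.
have mQ z : z \in x :: s -> z \in Q by rewrite -sQ mem_sort.
have [Y [sY pY YP]] := pick_between pQ (fun a b aI bI => gap a b (mQ a aI) (mQ b bI)).
have uY : uniq Y by move/path_sorted: pY; exact: lt_sorted_uniq.
have Yd t : t \in Y -> fdom p t /\ jump l t != 0.
  move=> /YP[/andP[xt tl] jt]; split=> //.
  have [_ [_ _ /andP[x1 _] _]] := QP x (mQ x (mem_head _ _)).
  have [_ [_ _ /andP[_ lp] _]] := QP _ (mQ _ (mem_last x s)).
  by rewrite /fdom (ltW (le_lt_trans x1 xt)) (lt_le_trans tl lp).
have := H0_kinks_count uD fD fz rl nf uY Yd.
have dge := H0_deg_ge0 uD fD fz rl.
(* N sorted points leave N - 1 gaps, each containing a kink; [hN] allows fewer. *)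
have sN : (size Y).+1 = N.
  by rewrite sY -[LHS]/(size (x :: s)) -sQ size_sort size_map size_iota.
have := hN dge; rewrite -sN -!natr1; lra.
Qed.

Lemma scale_invariantX (g : R -> R) x k : scale_invariant p g -> 0 < x -> g (x * p%:R ^+ k) = g x.
Proof.
move=> pg x0; elim: k => [|k IHk]; first by rewrite mulr1.
by rewrite exprS mulrCA pg ?mulr_gt0 ?exprn_gt0.
Qed.

Lemma ev_to_fdom (f : T) (x : R) : 0 < x -> ev x f = ev (to_fdom p x) f.
Proof.
move=> x0; have [fx [k [j e]]] := to_fdomP hp x0; have y0 := fdom_gt0 fx.
have [fz|[l [_ [_ _ _ pg _] _ _ ffin]]] := T_cases f; first by rewrite !ev_Kzero.
rewrite !ev_fin ?ffin //; congr expR.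
have := scale_invariantX j pg x0; rewrite e (scale_invariantX k pg y0) /= => ->.
by [].
Qed.

Lemma basic_base i f (U : set T) : open U -> U f ->
  exists k, basic i k f /\ basic i k `<=` U.
Proof.
move=> oU Uf; have [e e0 eU] := open_space_ev oU Uf.
suff [s [sf sU]] : exists s : seq (rat * rat * bool), (forall c, c \in s -> atom i c f) /\
    forall g : T, (forall c, c \in s -> atom i c g) ->
      forall y, fdom p y -> `|ev y f - ev y g| < e.
  exists (pickle s); rewrite /basic pickleK; split; first by move=> c; exact: sf.
  move=> g hg; apply: eU => x x0; rewrite !(ev_to_fdom _ x0); apply: sU => //.
  by have [] := to_fdomP hp x0.
(* A Lipschitz constant common to all nonzero sections of the space: conditions at finitely many
   rational points then control a section on the whole period. *)
pose C := 6 * \sum_(t <- u) `|D (cls hp t)|.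
have C0 : 0 <= C by rewrite mulr_ge0 // sumr_ge0.
have p1' := ltW p1.
have lip (g : T) x y : T_val g <> @Kzero R -> in_period x -> in_period y ->
    `|fine (T_val g x) - fine (T_val g y)| <= C * `|x - y|.
  move=> gz; have [//|[l [_ rl gD _ _]]] := T_cases g.
  exact: H0_lipschitz uD gD gz rl _ _.
have fin (g : T) y : T_val g <> @Kzero R -> in_period y -> ev y g = expR (fine (T_val g y)).
  move=> gz /andP[y1 _]; have [//|[l [_ _ _ _ gf]]] := T_cases g.
  by rewrite ev_fin // gf // (lt_le_trans ltr01).
have fdomW y : fdom p y -> in_period y by move=> /andP[y1 /ltW yp]; rewrite /in_period y1.
have in1 : in_period 1 by rewrite /in_period lexx p1'.
have ypC y : in_period y -> `|y - 1| <= p%:R.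
  by move=> /andP[y1 yp]; rewrite ger0_norm ?subr_ge0 //; lra.
have [fz|[l [fz rl fD nf ffin]]] := T_cases f.
  (* Near the zero section one condition at 1 is enough: a section moves by at most C p away from
     its value at 1, so a value there below [ln e - C p] keeps the exponential below e. *)
  have [r] : exists r : rat, ratr r \in `]ln e - C * p%:R - i%:R * pi - 1, ln e - C * p%:R - i%:R * pi[.
    by apply: rat_in_itvoo; rewrite gtrBl.
  rewrite in_itv /= => /andP[_ rlt].
  have q1 : ratr 1 = 1 :> R by rewrite rmorph1.
  exists [:: (1, r, true)]; split=> [c|g hg y fy].
    by rewrite inE => /eqP-> _ /=; rewrite ev_Kzero // expR_gt0.
  rewrite ev_Kzero // sub0r normrN.
  have [gz|gz] := pselect (T_val g = @Kzero R); first by rewrite ev_Kzero // normr0.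
  have := hg _ (mem_head _ _); rewrite /atom /= q1 => /(_ in1).
  rewrite !fin ?(fdomW y) // ltr_expR ger0_norm ?expR_ge0 // => g1.
  have -> : e = expR (ln e) by rewrite lnK.
  rewrite ltr_expR.
  have := lip g y 1 gz (fdomW y fy) in1.
  have := ler_wpM2l C0 (ypC y (fdomW y fy)).
  have := ler_norm (fine (T_val g y) - fine (T_val g 1)).
  rewrite /level in g1; lra.
pose h y := fine (T_val f y).
pose M := h 1 + C * p%:R.
have hM y : in_period y -> h y <= M.
  move=> yp; have := lip f y 1 fz yp in1; have := ler_wpM2l C0 (ypC y yp).
  by have := ler_norm (h y - h 1); rewrite /M /h; lra.
(* Tolerance for logarithms: a third each for the variation of f, for that of g and for the window
   of levels. The bound 1 keeps g below M + 1, where exp has Lipschitz constant [expR (M + 1)]. *)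
pose eta := Num.min 1 (e / (2 * expR (M + 1))).
have eta0 : 0 < eta by rewrite lt_min ltr01 divr_gt0 // mulr_gt0 ?expR_gt0.
have [m mP] : exists m, C * m.+1%:R^-1 <= eta / 3.
  exists (Num.truncn (3 * C / eta)); rewrite ler_pdivrMr //.
  have := @truncnS_gt R (3 * C / eta); rewrite ltr_pdivrMr // mulrC; lra.
have m0 : 0 < m.+1%:R :> R by [].
pose q (j : nat) : rat := 1 + j%:R / m.+1%:R.
have qE j : ratr (q j) = 1 + j%:R / m.+1%:R :> R.
  by rewrite rmorphD rmorph1 fmorph_div /= !ratr_nat.
have /choice[r hr] : forall j, exists r : rat * rat,
    [/\ h (ratr (q j)) - eta / 3 < level i r.1, level i r.1 < h (ratr (q j)),
        h (ratr (q j)) < level i r.2 & level i r.2 < h (ratr (q j)) + eta / 3].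
  move=> j; set v := h _; have e30 : 0 < eta / 3 by rewrite divr_gt0.
  have [r1] : exists r : rat, ratr r \in `]v - eta / 3 - i%:R * pi, v - i%:R * pi[.
    by apply: rat_in_itvoo; lra.
  have [r2] : exists r : rat, ratr r \in `]v - i%:R * pi, v + eta / 3 - i%:R * pi[.
    by apply: rat_in_itvoo; lra.
  rewrite !in_itv /= => /andP[h1 h2] /andP[h3 h4].
  by exists (r1, r2); rewrite /level /=; split; lra.
pose s := flatten [seq [:: (q j, (r j).2, true); (q j, (r j).1, false)] | j <- iota 0 (m.+1 * p)].
have sP c : c \in s -> exists j, c = (q j, (r j).2, true) \/ c = (q j, (r j).1, false).
  move=> /flattenP[_ /mapP[j _ ->]]; rewrite !inE => /orP[/eqP->|/eqP->]; exists j; auto.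
exists s; split=> [c /sP[j [->|->]] /= jp|g hg y fy].
- by rewrite /= fin // ltr_expR; have [_ _ ? _] := hr j.
- by rewrite /= fin // ltr_expR; have [_ ? _ _] := hr j.
pose j := Num.truncn ((y - 1) * m.+1%:R).
have yp := fdomW y fy; have [y1 yp'] := andP yp.
have ym0 : 0 <= (y - 1) * m.+1%:R by rewrite mulr_ge0 // subr_ge0.
have /andP[j1 j2] := truncn_itv ym0; rewrite -/j in j1 j2.
have qy : ratr (q j) <= y by rewrite qE addrC -lerBrDr ler_pdivrMr.
have yq : y - ratr (q j) <= m.+1%:R^-1.
  rewrite qE -[X in _ <= X]mul1r ler_pdivlMr // mulrBl mulrDl divfK ?gt_eqF // mul1r.
  rewrite mulrBl mul1r -natr1 in j2; lra.
have qp : in_period (ratr (q j)).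
  by rewrite /in_period (le_trans qy yp') andbT qE lerDl divr_ge0.
have jlt : (j < m.+1 * p)%N.
  rewrite -(ltr_nat R) natrM mulrC; apply: le_lt_trans j1 _.
  by rewrite ltr_pM2r // ltrBlDr (le_lt_trans yp') // ltrDl.
have c1 : (q j, (r j).2, true) \in s.
  apply/flattenP; exists [:: (q j, (r j).2, true); (q j, (r j).1, false)]; last exact: mem_head.
  by apply/mapP; exists j => //; rewrite mem_iota.
have c2 : (q j, (r j).1, false) \in s.
  apply/flattenP; exists [:: (q j, (r j).2, true); (q j, (r j).1, false)].
    by apply/mapP; exists j => //; rewrite mem_iota.
  by rewrite !inE eqxx orbT.
have := hg _ c1 qp; have := hg _ c2 qp; rewrite /=.
(* The lower condition excludes the zero section. *)
have [gz|gz] := pselect (T_val g = @Kzero R).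
  by rewrite ev_Kzero // => /(lt_trans (expR_gt0 _)); rewrite ltxx.
rewrite !fin // !ltr_expR => g1 g2.
have [r1 r2 r3 r4] := hr j.
have d1 := lip g y _ gz yp qp; have d2 := lip f y _ fz yp qp.
have dq : C * `|y - ratr (q j)| <= eta / 3.
  by apply: le_trans mP; rewrite ler_wpM2l // ger0_norm ?subr_ge0.
have d3 : `|h y - fine (T_val g y)| <= eta.
  move: (le_trans d1 dq) (le_trans d2 dq); rewrite !ler_norml -/(h y) -/(h (ratr (q j))).
  by move=> /andP[a1 a2] /andP[b1 b2]; apply/andP; split; lra.
have eta1 : eta <= 1 by rewrite ge_min lexx.
have fM : h y <= M + 1 by have := hM y yp; lra.
have gM : fine (T_val g y) <= M + 1.
  by move: d3; rewrite ler_norml => /andP[? _]; have := hM y yp; lra.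
apply: le_lt_trans (expR_dist fM gM) _.
have : expR (M + 1) * `|h y - fine (T_val g y)| <= expR (M + 1) * eta.
  by rewrite ler_wpM2l ?expR_ge0.
move=> /le_lt_trans; apply.
have : eta <= e / (2 * expR (M + 1)) by rewrite ge_min lexx orbT.
rewrite ler_pdivlMr ?mulr_gt0 ?expR_gt0 // => he; lra.
Qed.

Lemma covering_bound_H0le : covering_bound T N.
Proof.
apply: (covering_bound_zero_dim (G := off_levels) (B := basic) (Bc := closed_basic)).
- exact: off_levels_cover.
- by move=> i k _; exact: open_basic.
- by move=> i k _; exact: closed_closed_basic.
- exact: basic_closed_basic.
- exact: closed_basic_off_levels.
- by move=> i f U _ _; exact: basic_base.
Qed.

End UpperBound.

(** * Lower bound *)

Lemma unit_cube0 (R : realType) k : @unit_cube R k 0.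
Proof. by move=> i; rewrite mxE lexx ler01. Qed.

Section LowerBound.
Variables (R : realType) (p : nat).
Hypothesis hp : prime p.
Variables (D : Cp R p -> R) (us : seq R) (n k : nat) (z : int).
Local Notation m := k.+1.
Hypothesis uD : supports hp us D.
Local Notation d t := (D (cls hp t) / t).
Hypothesis dn : forall t, t \in us -> exists v : int, d t * p%:R ^+ n = v%:~R.
(** Jumps [- d t] cancel D, and m free kinks of size [p^-n] are added. The jumps then sum to
    [p^-n z (p - 1)], which cancels the denominator p - 1 of the initial slope. The two bounds that
    follow put the mean position of the free kinks in (1, p). *)
Hypothesis mz : m%:R - p%:R ^+ n * \sum_(t <- us) d t = z%:~R * (p%:R - 1).
Hypotheses (mlow : m%:R < p%:R ^+ n * deg D) (mhigh : p%:R ^+ n * deg D < p%:R * m%:R).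

Local Notation rho := (p%:R ^+ n : R).
Local Notation T := (H0le_space D rho).
Let p0 : 0 < p%:R :> R. Proof. by rewrite ltr0n prime_gt0. Qed.
Let p1 : 1 < p%:R :> R. Proof. by rewrite ltr1n prime_gt1. Qed.
Let pn0 : 0 < p%:R ^+ n :> R. Proof. by rewrite exprn_gt0. Qed.
Let m0 : 0 < m%:R :> R. Proof. by []. Qed.

Let A : R := p%:R ^+ n * deg D / m%:R.
Let A1 : 1 < A. Proof. by rewrite ltr_pdivlMr // mul1r. Qed.
Let Ap : A < p%:R. Proof. by rewrite ltr_pdivrMr. Qed.

(** All free kinks and the sample points used lie within [eps m] of the mean A, which is half the
    distance from A to the ends of (1, p). *)
Let eps : R := Num.min (A - 1) (p%:R - A) / (2 * m%:R).
Let eps0 : 0 < eps.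
Proof. by rewrite divr_gt0 ?mulr_gt0 // lt_min !subr_gt0 A1. Qed.
Let epsm : eps * m%:R < Num.min (A - 1) (p%:R - A).
Proof.
rewrite /eps; set c := Num.min _ _.
have c0 : 0 < c by rewrite lt_min !subr_gt0 A1.
have -> : c / (2 * m%:R) * m%:R = c / 2 by field; rewrite gt_eqF.
lra.
Qed.

(** Coordinates numbered from 1 to k = m - 1 and extended by 0; the values at 0 and m give
    [mu 0 = mu m = 0]. *)
Definition coord (v : 'rV[R]_k) (i : nat) : R :=
  if i is j.+1 then (if insub j is Some j' then v ord0 j' else 0) else 0.

(* The kinks are lam j = A + mu (j+1) - mu j with mu 0 = mu m = 0, so that their
   sum does not depend on the parameters, while the value of the section at a
   point between lam (i-1) and lam i is an affine function of mu i. *)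
Definition mu (v : 'rV[R]_k) (i : nat) : R :=
  - (eps * i%:R * (m%:R - i%:R)) + eps / 4 * coord v i.
Definition lam v j : R := A + mu v j.+1 - mu v j.
Definition sample (i : nat) : R := A - eps * (m%:R - 2 * i%:R).

Lemma coord_cube v i : unit_cube v -> 0 <= coord v i <= 1.
Proof.
move=> cv; case: i => [|j] /=; first by rewrite lexx ler01.
by case: insub => [j'|]; [exact: cv | rewrite lexx ler01].
Qed.

Lemma coord_m v : coord v m = 0.
Proof. by rewrite /= insubF // ltnn. Qed.

Lemma coord_dist (v v' : 'rV[R]_k) (c : R) i : 0 <= c -> (forall i, `|v ord0 i - v' ord0 i| <= c) ->
  `|coord v i - coord v' i| <= c.
Proof.
move=> c0 h; case: i => [|j] /=; first by rewrite subrr normr0.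
by case: insub => [j'|]; [exact: h | rewrite subrr normr0].
Qed.

(** The quadratic term of [mu] spaces the unperturbed kinks by 2 eps, with the sample points
    half-way. The parameters move a kink by at most eps / 4, so none crosses a sample point. *)
Lemma lamE v j : lam v j = A - eps * (m%:R - 2 * j%:R - 1) + eps / 4 * (coord v j.+1 - coord v j).
Proof. rewrite /lam /mu -[j.+1%:R]natr1; ring. Qed.

Lemma coordB_le v j : unit_cube v ->
  - (eps / 4) <= eps / 4 * (coord v j.+1 - coord v j) <= eps / 4.
Proof.
move=> cv; have /andP[a1 a2] := coord_cube j.+1 cv; have /andP[b1 b2] := coord_cube j cv.
have e40 : 0 <= eps / 4 by rewrite divr_ge0 // ltW.
set c := _ - coord v j; have c1 : c <= 1 by rewrite /c; lra.
have c2 : -1 <= c by rewrite /c; lra.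
by have := ler_wpM2l e40 c1; have := ler_wpM2l e40 c2; rewrite mulrN1 mulr1 => -> ->.
Qed.

Lemma sum_lam v i : \sum_(j <- iota 0 i) lam v j = i%:R * A + mu v i.
Proof.
elim: i => [|i IHi]; first by rewrite big_nil /mu /=; ring.
rewrite -[in LHS]addn1 iotaD big_cat /= big_seq1 IHi add0n /lam -natr1; ring.
Qed.

Lemma lam_fdom v j : unit_cube v -> (j < m)%N -> fdom p (lam v j).
Proof.
move=> cv jm; rewrite lamE.
have /andP[h4 h3] := coordB_le j cv.
have jm' : j%:R + 1 <= m%:R :> R by rewrite natr1 ler_nat.
have j0 : 0 <= j%:R :> R by [].
have := epsm; rewrite lt_min => /andP[e1 e2].
have h1 : eps * (m%:R - 2 * j%:R - 1) <= eps * (m%:R - 1) by rewrite ler_pM2l //; lra.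
have h2 : eps * (1 - m%:R) <= eps * (m%:R - 2 * j%:R - 1) by rewrite ler_pM2l //; lra.
by have e0 := eps0; apply/andP; split; lra.
Qed.

Definition indices := iota 0 m.

Lemma mem_indices j : (j \in indices) = (j < m)%N.
Proof. by rewrite mem_iota. Qed.

Definition divisor_kinks : seq (R * R) := [seq (t, - d t) | t <- us].
Definition free_kinks v : seq (R * R) := [seq (lam v j, (p%:R ^+ n)^-1) | j <- indices].
Definition all_kinks v := divisor_kinks ++ free_kinks v.

Lemma Hp_d t : t \in us -> Hp R p (d t).
Proof. by move=> /dn[v e]; exists v, n; rewrite -e mulfK // gt_eqF. Qed.

Lemma kinks_all v : unit_cube v -> kinks p (all_kinks v).
Proof.
move=> cv q; have [_ fu _] := uD.
rewrite mem_cat => /orP[/mapP[t tu ->]|/mapP[j]] /=.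
  by split; [exact: fu | apply: HpN => //; exact: Hp_d].
rewrite mem_indices => jm -> /=; split; first exact: lam_fdom.
exact: Hp_pinv.
Qed.

Lemma sum_all_kinks v : \sum_(q <- all_kinks v) q.2 = z%:~R * (p%:R - 1) / p%:R ^+ n.
Proof.
rewrite big_cat !big_map /= sumrN big_const_seq count_predT iter_addr_0 size_iota.
rewrite -mz mulrBl mulrAC divff ?mul1r ?gt_eqF // addrC mulr_natl.
by [].
Qed.

Lemma initial_slope_all v : initial_slope p (all_kinks v) = - (p%:R * z%:~R) / p%:R ^+ n.
Proof.
rewrite /initial_slope sum_all_kinks; field.
by rewrite gt_eqF //= gt_eqF // subr_gt0.
Qed.

Lemma Hp_initial_slope_all v : Hp R p (initial_slope p (all_kinks v)).
Proof.
rewrite initial_slope_all; apply: HpM => //; last exact: Hp_pinv.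
by apply: HpN => //; apply: HpM => //; [exact: Hp_nat | exact: Hp_int].
Qed.

Lemma moment_all v : \sum_(q <- all_kinks v) q.1 * q.2 = 0.
Proof.
rewrite big_cat !big_map /= -mulr_suml sum_lam.
have -> : mu v m = 0 by rewrite /mu coord_m subrr !mulr0 oppr0 addr0.
have -> : \sum_(t <- us) t * - d t = - deg D.
  rewrite (deg_supports uD) -sumrN !big_seq; apply: eq_bigr => t tu.
  have [_ fu _] := uD; have t0 := fdom_gt0 (fu t tu).
  by rewrite mulrN mulrCA divff ?mulr1 // gt_eqF.
by rewrite /A; field; rewrite !gt_eqF.
Qed.

Definition family v : R -> \bar R := periodic_section p 0 (all_kinks v).

Lemma represents_family v : unit_cube v -> represents p (fine \o family v) (all_kinks v).
Proof.
move=> cv; apply: periodic_section_represents => //;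
  [exact: kinks_all | exact: Hp_initial_slope_all | exact: moment_all].
Qed.

Lemma jump_all v y : fdom p y -> D (cls hp y) + y * jump (all_kinks v) y =
  y * \sum_(j <- indices | lam v j == y) (p%:R ^+ n)^-1.
Proof.
move=> fy; have y0 := fdom_gt0 fy; have [uu _ u0] := uD.
rewrite /jump big_cat !big_map /= mulrDr addrA -[RHS]add0r; congr (_ + _).
have [yu|yu] := boolP (y \in us).
  rewrite big_mkcond (bigD1_seq y) //= eqxx big1 ?addr0; last by move=> t /negPf ->.
  by rewrite mulrN mulrCA divff ?mulr1 ?subrr // gt_eqF.
rewrite u0 // big_seq_cond big1 ?mulr0 ?addr0 // => t /andP[tu /eqP ty].
by move: yu; rewrite -ty tu.
Qed.

Lemma family_H0le v : unit_cube v -> H0le D rho (family v).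
Proof.
move=> cv; have rf := represents_family cv; have [kl hi mom _ _] := rf.
split; last first.
  apply: (Knorm_le hp rf) => y fy.
  have hint (P : pred R) : exists w : int,
      (initial_slope p (all_kinks v) + \sum_(q <- all_kinks v | P q.1) q.2) * p%:R ^+ n = w%:~R.
    have [w hw] : exists w : int, \sum_(q <- all_kinks v | P q.1) q.2 * p%:R ^+ n = w%:~R.
      rewrite big_seq_cond; elim/big_ind: _ => [|a b [i ->] [j ->]|q /andP[qk _]].
      - by exists 0.
      - by exists (i + j); rewrite rmorphD.
      move: qk; rewrite mem_cat => /orP[/mapP[t tu ->]|/mapP[j _ ->]] /=.
        by have [i e] := dn tu; exists (- i); rewrite mulNr e rmorphN.
      by exists 1; rewrite mulVf // gt_eqF.
    exists (- (p%:Z * z) + w); rewrite mulrDl mulr_suml hw initial_slope_all.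
    by rewrite divfK ?gt_eqF // rmorphD rmorphN rmorphM /=.
  have [w hw] := hint (fun t => t <= y); have [w' hw'] := hint (fun t => t < y).
  by exists w => //; exists w'.
split; first exact: (periodic_section_K hp 0 kl hi mom).
right=> H; have [y fy ->] := cls_surj hp H.
rewrite (divisor_represents hp rf fy) jump_all // mulr_ge0 ?sumr_ge0 //.
by rewrite ltW // (fdom_gt0 fy).
Qed.

Lemma pl_family v y : pl p 0 (all_kinks v) y =
  - (p%:R * z%:~R) / p%:R ^+ n * (y - 1) +
  \sum_(t <- us) - d t * Num.max 0 (y - t) +
  (p%:R ^+ n)^-1 * \sum_(j <- indices) Num.max 0 (y - lam v j).
Proof.
rewrite /pl initial_slope_all add0r -addrA; congr (_ + _).
by rewrite big_cat !big_map /= mulr_sumr.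
Qed.

Definition offset (i : nat) : R :=
  - (p%:R * z%:~R) / p%:R ^+ n * (sample i - 1) +
  \sum_(t <- us) - d t * Num.max 0 (sample i - t) +
  (p%:R ^+ n)^-1 * (i%:R * (sample i - A)).

(** Exactly the kinks of index below i precede [sample i], and their positions sum to i A plus
    [mu v i]; the value thus depends on a single coordinate of v. *)
Lemma pl_sample v i : unit_cube v -> (i <= m)%N ->
  pl p 0 (all_kinks v) (sample i) = offset i - (p%:R ^+ n)^-1 * mu v i.
Proof.
move=> cv im; rewrite pl_family /offset -[RHS]addrA; congr (_ + _).
rewrite -mulrBr; congr (_ * _).
have e0 := eps0.
have hb j := coordB_le j cv.
rewrite /indices -(subnKC im) iotaD big_cat /= add0n [X in _ + X]big_seq [X in _ + X]big1 ?addr0; last first.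
  move=> j; rewrite mem_iota => /andP[ij _]; rewrite max_l // subr_le0 lamE /sample.
  have /andP[h1 h2] := hb j.
  have : eps * i%:R <= eps * j%:R by rewrite ler_pM2l // ler_nat.
  lra.
transitivity (\sum_(j <- iota 0 i) (sample i - lam v j)).
  rewrite !big_seq; apply: eq_bigr => j; rewrite mem_iota add0n => /andP[_ ji].
  rewrite max_r // subr_ge0 lamE /sample.
  have /andP[h1 h2] := hb j.
  have : eps * (j%:R + 1) <= eps * i%:R by rewrite ler_pM2l // natr1 ler_nat.
  lra.
rewrite sumrB sum_lam big_const_seq count_predT iter_addr_0 size_iota -mulr_natl; ring.
Qed.

Lemma family_fdom v y : fdom p y -> fine (expeR (family v y)) = expR (pl p 0 (all_kinks v) y).
Proof.
move=> fy; rewrite -(periodic_section_fdom hp 0 _ fy) /family /periodic_section.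
by rewrite leNgt (fdom_gt0 fy).
Qed.

Lemma pl_family_dist (v v' : 'rV[R]_k) (c : R) y : 0 <= c -> (forall i, `|v ord0 i - v' ord0 i| <= c) ->
  `|pl p 0 (all_kinks v) y - pl p 0 (all_kinks v') y| <= m%:R * (eps * c).
Proof.
move=> c0 h; rewrite !pl_family.
have cancel (a b b' : R) : a + b - (a + b') = b - b' by ring.
rewrite cancel -mulrBr -sumrB.
rewrite normrM ger0_norm; last by rewrite invr_ge0 ltW.
apply: (@le_trans _ _ (1 * (m%:R * (eps * c)))); last by rewrite mul1r.
apply: ler_pM => //.
  by rewrite invf_le1 // exprn_ege1 // ltW.
apply: le_trans (ler_norm_sum _ _ _) _.
apply: (@le_trans _ _ (\sum_(j <- indices) eps * c)); last first.
  by rewrite big_const_seq count_predT iter_addr_0 size_iota mulr_natl.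
apply: ler_sum => j _; apply: le_trans (max0_dist _ _) _.
have e0 := eps0.
have -> : y - lam v j - (y - lam v' j) =
    eps / 4 * ((coord v' j.+1 - coord v j.+1) + (coord v j - coord v' j)).
  rewrite !lamE; ring.
rewrite normrM ger0_norm; last by rewrite divr_ge0 // ltW.
have h' i : `|v' ord0 i - v ord0 i| <= c by rewrite distrC.
have := ler_normD (coord v' j.+1 - coord v j.+1) (coord v j - coord v' j).
have := coord_dist j.+1 c0 h'; have := coord_dist j c0 h.
set x := `|_ + _| => x1 x2 x3; have x4 : x <= 4 * c by lra.
rewrite -mulrA ler_pM2l // mulrC ler_pdivrMr // mulrC; exact: x4.
Qed.

Lemma pl_family_bound v y : unit_cube v -> fdom p y ->
  pl p 0 (all_kinks v) y <= pl p 0 (all_kinks 0) y + m%:R * eps.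
Proof.
move=> cv fy; have h i : `|v ord0 i - (0 : 'rV[R]_k) ord0 i| <= 1.
  by rewrite mxE subr0 ger0_norm; have /andP[] := cv i.
have := pl_family_dist y ler01 h; rewrite mulr1.
have := ler_norm (pl p 0 (all_kinks v) y - pl p 0 (all_kinks 0) y); lra.
Qed.

Definition family_space (v : 'rV[R]_k) : T :=
  if pselect (unit_cube v) is left cv then SigSub (mem_set (family_H0le cv))
  else SigSub (mem_set (family_H0le (@unit_cube0 R k))).

Lemma family_spaceE v x : unit_cube v -> ev x (family_space v) = fine (expeR (family v x)).
Proof. by move=> cv; rewrite /ev /family_space; case: pselect. Qed.

Lemma family_continuous : cube_continuous family_space.
Proof.
move=> v cv U oU Uv; have [e e0 eU] := open_space_ev oU Uv.
have [kl0 _ _ _ _] := represents_family (@unit_cube0 R k).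
pose S := \sum_(t <- undup [seq q.1 | q <- all_kinks 0]) `|jump (all_kinks 0) t|.
(* A common upper bound for the logarithms, exp being only locally Lipschitz: the Lipschitz estimate
   for the member at 0, which vanishes at 1, plus the largest displacement within the cube. *)
pose M := 3 * S * p%:R + m%:R * eps.
have MP v' y : unit_cube v' -> fdom p y -> pl p 0 (all_kinks v') y <= M.
  move=> cv' fy; apply: le_trans (pl_family_bound cv' fy) _; rewrite lerD2r.
  have /andP[y1 yp] := fy.
  have uw : uniq (undup [seq q.1 | q <- all_kinks 0]) by apply: undup_uniq.
  have lw : {subset [seq q.1 | q <- all_kinks 0] <= undup [seq q.1 | q <- all_kinks 0]}.
    by move=> t; rewrite mem_undup.
  have yI : 1 <= y <= p%:R by rewrite y1 ltW.
  have oneI : 1 <= (1 : R) <= p%:R by rewrite lexx ltW.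
  have := pl_lipschitz hp 0 yI oneI uw lw; rewrite pl1 // subr0 -/S.
  move=> h; apply: le_trans (ler_norm _) (le_trans h _).
  rewrite ler_wpM2l ?mulr_ge0 ?sumr_ge0 // ger0_norm ?subr_ge0 //; lra.
have me0 : 0 < m%:R * eps by rewrite mulr_gt0.
pose dl := e / (2 * (expR M * (m%:R * eps))).
have dl0 : 0 < dl by rewrite divr_gt0 // mulr_gt0 // mulr_gt0 // expR_gt0.
exists dl => // v' cv' h; apply: eU => x x0.
rewrite !(ev_to_fdom hp _ x0) !family_spaceE //.
have [fx _] := to_fdomP hp x0; rewrite !family_fdom //.
apply: le_lt_trans (expR_dist (MP _ _ cv fx) (MP _ _ cv' fx)) _.
have h' i : `|v ord0 i - v' ord0 i| <= dl by apply/ltW.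
have hd := pl_family_dist (to_fdom p x) (ltW dl0) h'.
apply: le_lt_trans (ler_wpM2l (expR_ge0 M) hd) _.
have -> : expR M * (m%:R * (eps * dl)) = e / 2.
  by rewrite /dl; field; rewrite !gt_eqF ?expR_gt0.
lra.
Qed.

Lemma sample_fdom (i : 'I_k) : fdom p (sample i.+1).
Proof.
have im : i.+1%:R + 1 <= m%:R :> R by rewrite natr1 ler_nat ltnS.
have i1 : 1 <= i.+1%:R :> R by rewrite ler1n.
have := epsm; rewrite lt_min => /andP[e1 e2]; have e0 := eps0.
have h1 : eps * (m%:R - 2 * i.+1%:R) <= eps * m%:R by rewrite ler_pM2l //; lra.
have h2 : eps * (- m%:R) <= eps * (m%:R - 2 * i.+1%:R) by rewrite ler_pM2l //; lra.
by rewrite /fdom /sample; apply/andP; split; lra.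
Qed.

Lemma not_covering_bound_H0le : ~ covering_bound T k.
Proof.
(* The value at a sample point decreases with its coordinate; the minus sign makes it increase from
   the face 0 to the face 1. *)
pose val (i : 'I_k) (c : R) : R := - expR (offset i.+1 -
  (p%:R ^+ n)^-1 * (- (eps * i.+1%:R * (m%:R - i.+1%:R)) + eps / 4 * c)).
have evE (i : 'I_k) v : unit_cube v -> - ev (sample i.+1) (family_space v) = val i (v ord0 i).
  move=> cv; rewrite family_spaceE // (family_fdom _ (sample_fdom i)) pl_sample //; last first.
    by rewrite ltnS ltnW.
  by rewrite /mu /= /val insubT ?ltn_ord //= => lt; congr (- expR (_ - _ * (_ + _ * v _ _))); apply: val_inj.
apply: (not_covering_bound_cube (e := family_space)
  (g := fun i f => - ev (sample i.+1) f) (a := fun i => val i 0) (b := fun i => val i 1)).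
- exact: family_continuous.
- move=> i f; apply: (@continuousN _ _ _ (ev (sample i.+1) : T -> R)).
  by apply: continuous_ev; apply: fdom_gt0 (sample_fdom i).
- move=> i; rewrite ltrN2 ltr_expR ltrD2l ltrN2 ltr_pM2l ?invr_gt0 // ltrD2l.
  by rewrite mulr0 mulr1 divr_gt0.
- by move=> i v cv vi; rewrite evE // vi.
- by move=> i v cv vi; rewrite evE // vi.
Qed.

End LowerBound.

(** * Asymptotics *)

Section Asymptotics.
Variables (R : realType) (p : nat).
Hypothesis hp : prime p.
Variable D : Cp R p -> R.
Hypothesis HD : Div D.

Let p0 : 0 < p%:R :> R. Proof. by rewrite ltr0n prime_gt0. Qed.
Let p1 : 1 < p%:R :> R. Proof. by rewrite ltr1n prime_gt1. Qed.
Let pn0 n : 0 < p%:R ^+ n :> R. Proof. by rewrite exprn_gt0. Qed.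

(** The space contains the zero section. This is the entire lower bound when deg D <= 0. *)
Lemma dim_top_H0le_ge0 n : (0 <= dim_top R (H0le_space D (p%:R ^+ n)))%E.
Proof.
apply: (@dim_top_ge R _ 0) => cov.
have hz : H0le D (p%:R ^+ n) (@Kzero R).
  split; first by split; left.
  rewrite /Knorm; case: ifPn => [_|/asboolP //].
  by rewrite lee_fin ltW.
pose f : H0le_space D (p%:R ^+ n) := SigSub (mem_set hz).
have fT : finite_set [set [set: H0le_space D (p%:R ^+ n)]] by apply: finite_set1.
have oT : open_cover [set [set: H0le_space D (p%:R ^+ n)]].
  split; first by move=> _ ->; exact: openT.
  by rewrite bigcup_set1.
have [V [[_ Vc] _ /(_ f)]] := cov _ fT oT.
have : [set: H0le_space D (p%:R ^+ n)] f by [].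
rewrite -Vc => -[A VA Af].
by rewrite II0 card_le0 => /eqP/seteqP[+ _] => /(_ A); apply.
Qed.

Lemma dim_seq_upper : exists C : R, forall n,
  (dim_seq D n <= (Num.max 0 (deg D) + C * p%:R ^- n)%:E)%E.
Proof.
have [u uD] := Div_supports hp HD; exists (size u).+1%:R => n.
set dm := Num.max 0 _; have dm0 : 0 <= dm by rewrite le_max lexx.
pose S : R := p%:R ^+ n * dm + (size u).+1%:R.
have S0 : 0 <= S by rewrite addr_ge0 // mulr_ge0 // ltW.
(* Order at most [truncn S + 1] means dimension at most [truncn S], hence at most S. *)
have cov : covering_bound (H0le_space D (p%:R ^+ n)) (Num.truncn S).+1.
  apply: (covering_bound_H0le uD) => // d0; apply: le_lt_trans (truncnS_gt _).
  by rewrite lerD2r ler_pM2l // le_max lexx orbT.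
have pV0 : 0 < p%:R ^- n :> R by rewrite invr_gt0.
apply: (@le_trans _ _ ((p%:R ^- n)%:E * S%:E)%E).
  apply: lee_wpmul2l; first by rewrite lee_fin ltW.
  apply: le_trans (dim_top_le R cov) _; rewrite lee_fin -natr1 addrK.
  by have /andP[] := truncn_itv S0.
rewrite -EFinM lee_fin /S mulrDr mulrA mulVf ?gt_eqF // mul1r mulrC.
by rewrite lerD2l mulrC.
Qed.

Lemma dim_seq_ge0 n : (0 <= dim_seq D n)%E.
Proof.
apply: mule_ge0; last exact: dim_top_H0le_ge0.
by rewrite lee_fin invr_ge0 ltW.
Qed.

Lemma common_denom (s : seq R) : (forall x, x \in s -> Hp R p x) ->
  exists n0, forall n, (n0 <= n)%N -> forall x, x \in s -> exists v : int, x * p%:R ^+ n = v%:~R.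
Proof.
elim: s => [|y s IHs] h; first by exists 0%N.
have [n1 h1] := IHs (fun x xs => h x (mem_behead (s := y :: s) xs)).
have [n2 [a e]] := proj1 (Hp_denom hp y) (h y (mem_head _ _)).
exists (maxn n1 n2) => n; rewrite geq_max => /andP[n1n n2n] x.
rewrite inE => /orP[/eqP->|]; last exact: h1.
exists (a * p%:Z ^+ (n - n2)); rewrite rmorphM rmorphXn /= -e.
by rewrite -mulrA -exprD subnKC.
Qed.

Lemma dim_seq_lower : 0 < deg D -> \forall n \near \oo,
  ((deg D - (p%:R + 1) * p%:R ^- n)%:E <= dim_seq D n)%E.
Proof.
move=> dD; have [u uD] := Div_supports hp HD; have [uu fu u0] := uD.
pose d t := D (cls hp t) / t.
have dHp x : x \in [seq d t | t <- u] -> Hp R p x.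
  move=> /mapP[t tu ->]; have [/(_ (cls hp t)) + _] := HD.
  have t0 := fdom_gt0 (fu t tu); rewrite set_val_cls ?gt_eqF // => -[y hy e].
  by rewrite /d -e mulrAC divff ?mul1r // gt_eqF.
have [n0 hn0] := common_denom dHp.
(* The threshold leaves at least two free kinks after rounding, and then [S < p m] holds. *)
have [n1 hn1] : exists n1, forall n, (n1 <= n)%N -> p%:R + 2 <= p%:R ^+ n * deg D.
  exists (Num.truncn ((p%:R + 2) / deg D)).+1 => n n1n.
  rewrite -ler_pdivrMr //; apply: le_trans (ltW (truncnS_gt _)) _.
  apply: (@le_trans _ _ n%:R); first by rewrite ler_nat.
  by rewrite -natrX ler_nat ltnW // ltn_expl // prime_gt1.
exists (maxn n0 n1) => // n /=; rewrite geq_max => /andP[n0n n1n].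
have [r rE] : exists r : int, p%:R ^+ n * \sum_(t <- u) d t = r%:~R.
  rewrite mulr_sumr big_seq; elim/big_ind: _ => [|a b [i ->] [j ->]|t tu].
  - by exists 0.
  - by exists (i + j); rewrite rmorphD.
  by have [v e] := hn0 n n0n (d t) (map_f _ tu); exists v; rewrite mulrC.
pose S : R := p%:R ^+ n * deg D; have S2 : p%:R + 2 <= S := hn1 n n1n.
have S0 : 0 <= S by rewrite mulr_ge0 // ltW.
have /andP[M1 M2] := truncn_itv S0; set M := Num.truncn S in M1 M2.
have pM : (p.+1 < M.+1)%N.
  by rewrite -(ltr_nat R) -natr1; apply: le_lt_trans M2; lra.
have p2 := prime_gt1 hp.
(* The number m = k + 1 of kinks is the largest integer below M congruent to r modulo p - 1; as q <=
   p - 2, this costs only k >= M - p. *)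
pose q : int := modz (M%:Z - 1 - r) (p%:Z - 1).
pose z : int := divz (M%:Z - 1 - r) (p%:Z - 1).
have qz : M%:Z - 1 - r = z * (p%:Z - 1) + q by exact: divz_eq.
have q0 : 0 <= q by apply: modz_ge0; lia.
have qp : q < p%:Z - 1 by apply: ltz_pmod; lia.
have [k kE] : exists k : nat, k.+1%:Z = M%:Z - 1 - q.
  by exists (absz (M%:Z - 2 - q)%R); lia.
have km : M%:Z - p%:Z <= k%:Z by lia.
have kM : (k.+1 < M)%N by lia.
have k2 : (1 < k.+1)%N by lia.
have mE : k.+1%:R = M%:R - 1 - q%:~R :> R.
  by have := congr1 (fun i : int => i%:~R : R) kE; rewrite !rmorphB /=.
have kMR : M%:R - p%:R <= k%:R :> R.
  by move: km; rewrite -(ler_int R) rmorphB.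
have nc : ~ covering_bound (H0le_space D (p%:R ^+ n)) k.
  apply: (@not_covering_bound_H0le R p hp D u n k z) => //.
  - by move=> t tu; exact: hn0 n n0n (d t) (map_f _ tu).
  - rewrite -[X in _ * X]/(\sum_(t <- u) d t) rE.
    have qzR : M%:R - 1 - r%:~R = z%:~R * (p%:R - 1) + q%:~R :> R.
      by have := congr1 (fun i : int => i%:~R : R) qz; rewrite [RHS]rmorphD [X in _ = X + _]rmorphM !rmorphB.
    by rewrite mE addrAC qzR addrK.
  - apply: lt_le_trans M1; by rewrite ltr_nat.
  apply: lt_le_trans M2 _; rewrite -natrM ler_nat.
  have : (k.+1%:Z + p%:Z - 1 >= M%:Z) by lia.
  nia.
have pV0 : 0 < p%:R ^- n :> R by rewrite invr_gt0.
apply: (@le_trans _ _ ((p%:R ^- n)%:E * (k%:R)%:E)%E); last first.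
  by apply: lee_wpmul2l (dim_top_ge R nc); rewrite lee_fin ltW.
rewrite -EFinM lee_fin.
have -> : deg D - (p%:R + 1) * p%:R ^- n = p%:R ^- n * (S - p%:R - 1).
  by rewrite /S; field; rewrite gt_eqF.
by rewrite ler_pM2l //; rewrite -natr1 in M2; lra.
Qed.

Lemma cvg_dim_seq : dim_seq D @ \oo --> (Num.max 0 (deg D))%:E.
Proof.
have cvgE (a c : R) : (fun n : nat => (a + c * p%:R ^- n)%:E) @ \oo --> a%:E.
  apply: cvg_EFin; first by near=> n.
  rewrite -[X in _ --> X]addr0; apply: cvgD; first exact: cvg_cst.
  rewrite -[X in _ --> X](mulr0 c); apply: cvgMr.
  have -> : (fun n => p%:R ^- n) = (fun n => p%:R^-1 ^+ n) :> (nat -> R).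
    by apply/funext => n; rewrite exprVn.
  by apply: cvg_expr; rewrite ger0_norm ?invr_ge0 ?(ltW p0) // invf_lt1.
have [C upper] := dim_seq_upper.
have [d0|d0] := ltP 0 (deg D).
  move: upper; rewrite max_r ?ltW // => upper.
  apply: (squeeze_cvge _ (cvgE (deg D) (- (p%:R + 1))) (cvgE (deg D) C)).
  apply: filterS (dim_seq_lower d0) => n h; apply/andP; split; last exact: upper.
  by rewrite mulNr.
move: upper; rewrite max_l // => upper.
apply: (squeeze_cvge _ (cvgE 0 0) (cvgE 0 C)).
near=> n; apply/andP; split; last exact: upper.
by rewrite mul0r addr0; exact: dim_seq_ge0.
Unshelve. all: by end_near. Qed.

End Asymptotics.

Lemma DivN (R : realType) (p : nat) (D : Cp R p -> R) : Div D -> Div (- D).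
Proof.
move=> [DH Df]; split.
  move=> H; have [[H0 HB] _] := set_valP H.
  by rewrite -[(- D) H]/(- D H) -sub0r; apply: HB => //; exact: DH.
apply: sub_finite_set Df => H /=.
by rewrite -[(- D) H]/(- D H) oppr_eq0.
Qed.

Lemma degN (R : realType) (p : nat) (hp : prime p) (D : Cp R p -> R) :
  Div D -> deg (- D) = - deg D.
Proof.
move=> HD; have [u uD] := Div_supports hp HD.
have uN : supports hp u (- D).
  have [uu fu u0] := uD; split=> // t ft tu.
  by rewrite -[(- D) _]/(- D _) u0 // oppr0.
by rewrite (deg_supports uD) (deg_supports uN) -sumrN.
Qed.

Theorem theorem6p7 (R : realType) (p : nat) (hp : prime p) :
  (forall D : Cp R p -> R, Div D -> 0 <= deg D ->
     cvgn (dim_seq D) /\ DimR D = (deg D)%:E)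
  /\
  (forall D : Cp R p -> R, Div D ->
     [/\ cvgn (dim_seq D), cvgn (dim_seq (- D)) &
         (DimR D - DimR (- D)%R)%E = (deg D)%:E]).
Proof.
have cvgD (D : Cp R p -> R) : Div D -> dim_seq D @ \oo --> (Num.max 0 (deg D))%:E.
  exact: cvg_dim_seq.
have DimE (D : Cp R p -> R) : Div D -> DimR D = (Num.max 0 (deg D))%:E.
  by move=> HD; apply: cvg_lim => //; exact: cvgD.
split=> D HD.
  move=> d0; split; first by apply/cvg_ex; eexists; exact: cvgD.
  by rewrite DimE // max_r.
split; [by apply/cvg_ex; eexists; exact: cvgD | |].
  by apply/cvg_ex; eexists; apply: cvgD; exact: DivN.
rewrite !DimE //; last exact: DivN.
rewrite degN // -EFinB; congr EFin.
by case: leP => d1; case: leP => d2; lra.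
Qed.
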